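(* Let $\alpha>1$, $\alpha'=\alpha/(\alpha-1)$, and let $\{X_{(\varepsilon)},\varepsilon>0\}$ be a family of $D[0,1]$-valued stochastic processes with $X_{(\varepsilon)}(0)=0$ for every $\varepsilon>0$. 1. Suppose there exist constants $c,C\in(0,\infty)$ such that for every $\lambda>0$, every $\varepsilon>0$ and every $0\le t_1\le t\le t_2\le1$, $\mathbb E[\exp(\lambda M(X_{(\varepsilon)}(t_1),X_{(\varepsilon)}(t),X_{(\varepsilon)}(t_2)))]\le c\exp(C(\lambda\varepsilon)^\alpha|t_2-t_1|)$. Then for every $\beta\in(0,1/\alpha)$, $\lim_{N\to\infty}\limsup_{\varepsilon\downarrow0}\varepsilon^{\alpha'}\log P\Big(\bigcup_{n>N}\big\{w_M(X_{(\varepsilon)},2^{-n})>2\frac{2^{-n\beta}}{1-2^{-\beta}}\big\}\Big)=-\infty.$ 2. Suppose further that for some countable dense subset $\mathcal D$ of $[0,1]$ containing $1$, the family of real random variables $\{X_{(\varepsilon)}(q),\varepsilon>0\}$ is exponentially tight with speed $\varepsilon^{-\alpha'}$ for every $q\in\mathcal D$. Then the laws of $X_{(\varepsilon)}$ as $\varepsilon\downarrow0$ are exponentially tight in $(D[0,1],\mathrm{dist})$ with speed $\varepsilon^{-\alpha'}$.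
   Context: $D[0,1]$ is the space of càdlàg functions $f:[0,1]\to\mathbb R$, with the convention $f(0-)=0$. For $x,y,z\in\mathbb R$, $M(x,y,z)=d(y,[x\wedge z,x\vee z])$ is the distance from $y$ to the interval between $x$ and $z$. The $M$-oscillation is $w_M(f,\delta)=\sup\{M(f(t_1-),f(t),f(t_2)):0\le t_1<t<t_2\le1,\ |t_2-t_1|<\delta\}$. Metric $\mathrm{dist}$: let $\Gamma_0(f)=\{(t,x):t\in[0,1],x\text{ between }f(t-)\text{ and }f(t)\}$, ordered by $(t,x)\preceq(u,y)$ iff $t<u$ or ($t=u$ and $|x-f(t-)|\le|y-f(t-)|$); $\Pi(f)$ is the set of increasing bijections $r\mapsto(t(r),x(r))$ of $[0,1]$ onto $\Gamma_0(f)$; $\mathrm{dist}(f_1,f_2)=\inf_{(t_i,x_i)\in\Pi(f_i)}\sup_r|t_1(r)-t_2(r)|\vee|x_1(r)-x_2(r)|$. A family $(Y_\varepsilon)$ of random elements of a space $S$ is exponentially tight with speed $\varepsilon^{-\beta}$ if for each $M<\infty$ there is a compact $K_M\subset S$ with $\limsup_{\varepsilon\downarrow0}\varepsilon^\beta\log P(Y_\varepsilon\notin K_M)\le-M$. *)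

(* Defs.v *)
From HB Require Import structures.
From mathcomp Require Import all_boot all_order all_algebra.
From mathcomp Require Import all_classical all_reals all_analysis.
Set Implicit Arguments. Unset Strict Implicit. Unset Printing Implicit Defensive.
Import Order.TTheory GRing.Theory Num.Theory Num.Def.
Import numFieldNormedType.Exports.
Local Open Scope classical_set_scope.
Local Open Scope ring_scope.

Section Defs.
Variable R : realType.

(* M(x,y,z) = d(y, [x /\ z, x \/ z]) : distance from y to the interval
   between x and z (written out explicitly) *)
Definition Mdist (x y z : R) : R :=
  Num.max 0 (Num.max (Num.min x z - y) (y - Num.max x z)).

(* càdlàg on [0,1]: right-continuous at every t in [0,1),
   left limit exists at every t in (0,1].  Elements of D[0,1] are
   represented by functions R -> R, only their values on [0,1] matter. *)
Definition cadlag (f : R -> R) : Prop :=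
  (forall t, 0 <= t -> t < 1 -> f x @[x --> t^'+] --> f t) /\
  (forall t, 0 < t -> t <= 1 -> cvg (f x @[x --> t^'-])).

Definition Dspace : set (R -> R) := [set f | cadlag f].

Definition leftlim (f : R -> R) (t : R) : R :=
  if t <= 0 then 0 else lim (f x @[x --> t^'-]).

Definition wM (f : R -> R) (delta : R) : \bar R :=
  ereal_sup [set e | exists t1 t t2,
     [/\ 0 <= t1 < t, t < t2 <= 1, `|t2 - t1| < delta
       & e = (Mdist (leftlim f t1) (f t) (f t2))%:E]].

Definition Gamma0 (f : R -> R) : set (R * R) :=
  [set p | [/\ 0 <= p.1, p.1 <= 1,
               Num.min (leftlim f p.1) (f p.1) <= p.2
             & p.2 <= Num.max (leftlim f p.1) (f p.1)]].

Definition graph_le (f : R -> R) (p q : R * R) : Prop :=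
  p.1 < q.1 \/
  (p.1 = q.1 /\ `|p.2 - leftlim f p.1| <= `|q.2 - leftlim f p.1|).

Definition Pi (f : R -> R) : set (R -> R * R) :=
  [set g | [/\ (forall r, 0 <= r -> r <= 1 -> Gamma0 f (g r)),
     (forall p, Gamma0 f p -> exists r, [/\ 0 <= r, r <= 1 & g r = p]),
     (forall r r', 0 <= r -> r <= 1 -> 0 <= r' -> r' <= 1 -> g r = g r' -> r = r')
   & (forall r r', 0 <= r -> r <= r' -> r' <= 1 -> graph_le f (g r) (g r'))]].

Definition dist (f1 f2 : R -> R) : \bar R :=
  ereal_inf [set e | exists g1 g2, [/\ Pi f1 g1, Pi f2 g2 &
     e = ereal_sup [set (Num.max `|(g1 r).1 - (g2 r).1| `|(g1 r).2 - (g2 r).2|)%:E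
                   | r in `[0, 1]]]].

Definition Dopen (U : set (R -> R)) : Prop :=
  U `<=` Dspace /\
  forall f, U f -> exists2 r : R, 0 < r &
    forall g, Dspace g -> (dist f g < r%:E)%E -> U g.

Definition Dcompact (K : set (R -> R)) : Prop :=
  K `<=` Dspace /\
  forall C : set (set (R -> R)), (forall U, C U -> Dopen U) ->
    K `<=` \bigcup_(U in C) U ->
    exists2 F : set (set (R -> R)), finite_set F /\ F `<=` C &
      K `<=` \bigcup_(U in F) U.

Definition eln (x : \bar R) : \bar R :=
  match x with
  | r%:E => if 0 < r then (ln r)%:E else -oo%E
  | +oo%E => +oo%E
  | -oo%E => -oo%E
  end.

Definition Pout d (T : measurableType d) (P : probability T R) (A : set T)
  : \bar R :=
  ereal_inf [set P B | B in [set B | measurable B /\ A `<=` B]].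

(* exponential tightness with speed eps^-gam of a family (Y eps)_{eps>0}
   of random elements of a space S whose compact sets are given by cpt *)
Definition exp_tight d (T : measurableType d) (P : probability T R)
  (S : Type) (cpt : set S -> Prop) (Y : R -> T -> S) (gam : R) : Prop :=
  forall Mc : R, exists2 K : set S, cpt K &
    (limf_esup (fun eps : R =>
        ((eps `^ gam)%:E * eln (Pout P [set w | ~ K (Y eps w)]))%E)
      (0^'+) <= (- Mc)%:E)%E.

End Defs.

(* Main.v *)
Require Import Defs.
From HB Require Import structures.
From mathcomp Require Import all_boot all_order all_algebra.
From mathcomp Require Import all_classical all_reals all_analysis.
From mathcomp Require Import measurable_realfun ring lra zify.
Set Implicit Arguments. Unset Strict Implicit. Unset Printing Implicit Defensive.
Import Order.TTheory GRing.Theory Num.Theory Num.Def.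
Import numFieldNormedType.Exports.
Local Open Scope classical_set_scope.
Local Open Scope ring_scope.

(** A family with small M-oscillation is controlled on dyadic grids: if every
    adjacent triple of every level [m >= n] has [M <= 2^(-m beta)], then replacing
    the points of a triple by neighbours on the next coarser grid costs at most
    twice that amount per level, and the losses add up to a geometric series
    bounding [w_M (f, 2^(-n))].  Chernoff's bound for the adjacent triples, with the
    exponential parameter [eps^(-alpha') 2^(m/alpha)], and a union bound over the
    [2^m] triples of each level [m > N] give the first part.

    For the second part, the finitely many values at a grid of mesh [2^(-N-1)] in
    the dense set and the modulus [w_M] bound the supremum, so that the paths
    stay, up to exponentially small probability, in a set
    [{sup |f| <= B, w_M (f, dl_n) <= eta_n for all n}] with [eta_n -> 0].  Such a set
    is compact: were there no finite subcover, Tychonoff's theorem would give a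
    pointwise cluster point [a] of the uncovered functions; it inherits the
    modulus, hence has one-sided limits, and its right-continuous version [f]
    lies in the set.  The points [(t, a t)] lie on the completed graph of [f], and a
    function of the set whose values are close to those of [a] on a fine grid is
    [dist]-close to [f]: between two consecutive grid points both completed graphs
    are monotone up to [eta_n], so that they can be matched through points at
    prescribed intermediate heights. *)

(** * Extension of a path to the real line *)

Section OneSidedLimits.
Context {R : realType}.
Implicit Types (f : R -> R) (t l e d : R).

Lemma cvg_right_epsP f t l : f x @[x --> t^'+] --> l <->
  forall e, 0 < e -> exists2 d, 0 < d &
    forall s, t < s -> s < t + d -> `|f s - l| < e.
Proof.
split=> [/cvgrPdist_lt H e e0|H].
  have := H e e0; rewrite near_withinE => /nbhs_ballP[d /= d0 Hd].
  exists d => // s ts std; rewrite distrC; apply: Hd => //=.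
  by rewrite /ball/= distrC ger0_norm; lra.
apply/cvgrPdist_lt => e e0; have [d d0 Hd] := H e e0.
rewrite near_withinE; apply/nbhs_ballP; exists d => //= s.
by rewrite /ball/= ; rewrite ltr_norml => /andP[? ?] ts; rewrite distrC; apply: Hd => //; lra.
Qed.

Lemma cvg_left_epsP f t l : f x @[x --> t^'-] --> l <->
  forall e, 0 < e -> exists2 d, 0 < d &
    forall s, t - d < s -> s < t -> `|f s - l| < e.
Proof.
split=> [/cvgrPdist_lt H e e0|H].
  have := H e e0; rewrite near_withinE => /nbhs_ballP[d /= d0 Hd].
  exists d => // s ts std; rewrite distrC; apply: Hd => //=.
  by rewrite /ball/= ger0_norm; lra.
apply/cvgrPdist_lt => e e0; have [d d0 Hd] := H e e0.
rewrite near_withinE; apply/nbhs_ballP; exists d => //= s.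
by rewrite /ball/= ; rewrite ltr_norml => /andP[? ?] ts; rewrite distrC; apply: Hd => //; lra.
Qed.

End OneSidedLimits.

Section Extension.
Context {R : realType}.
Implicit Types (f : R -> R) (t e d : R).

(* Extending by [0] to the left encodes the convention [f (0-) = 0]. *)
Definition ext f t : R := if t < 0 then 0 else if t < 1 then f t else f 1.

Lemma ext_lt0 f t : t < 0 -> ext f t = 0.
Proof. by rewrite /ext => ->. Qed.

Lemma ext_ge1 f t : 1 <= t -> ext f t = f 1.
Proof. by move=> t1; rewrite /ext ltNge (le_trans ler01 t1) /= ltNge t1. Qed.

Lemma ext01 f t : 0 <= t <= 1 -> ext f t = f t.
Proof.
move=> /andP[t0 t1]; rewrite /ext ltNge t0 /=; case: ifPn => // nt1.
by congr f; lra.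
Qed.

Lemma ext_right f t : cadlag f -> forall e, 0 < e -> exists2 d, 0 < d &
  forall s, t < s -> s < t + d -> `|ext f s - ext f t| < e.
Proof.
move=> [fr _] e e0; have [t0|t0] := ltP t 0.
  exists (- t) => [|s ts st]; first by lra.
  by rewrite !ext_lt0 ?subrr ?normr0 //; lra.
have [t1|t1] := ltP t 1; last first.
  by exists 1 => // s ts st; rewrite !ext_ge1 ?subrr ?normr0 //; lra.
have /cvg_right_epsP/(_ e e0)[d d0 Hd] := fr _ t0 t1.
exists (Num.min d (1 - t)); first by rewrite lt_min d0 /=; lra.
move=> s ts; rewrite -ltrBlDl lt_min => /andP[sd s1].
by rewrite !ext01; [apply: Hd|..]; lra.
Qed.

Lemma ext_left f t : cadlag f -> 0 <= t <= 1 ->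
  forall e, 0 < e -> exists2 d, 0 < d &
  forall s, t - d < s -> s < t -> `|ext f s - leftlim f t| < e.
Proof.
move=> [_ fl] /andP[t0 t1] e e0; rewrite /leftlim; case: ifPn => [tle|].
  by exists 1 => // s _ st; rewrite ext_lt0 ?subrr ?normr0 //; lra.
rewrite -ltNge => tgt; have /cvg_left_epsP/(_ e e0)[d d0 Hd] := fl _ tgt t1.
exists (Num.min d t); first by rewrite lt_min d0.
move=> s; rewrite ltrBlDr -ltrBlDl lt_min => /andP[sd s1] st.
by rewrite ext01; [apply: Hd|]; lra.
Qed.

End Extension.

Section Betweenness.
Context {R : realType}.
Implicit Types (e x y z : R).

(** For nonnegative [e] this is [Mdist x y z <= e], with disjunctions in place of [min] and [max] so
    that case analysis leaves linear goals for [lra]. *)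
Definition btw e x y z : bool :=
  ((y <= x + e) || (y <= z + e)) && ((x - e <= y) || (z - e <= y)).

Lemma Mdist_le e x y z : (Mdist x y z <= e) = (0 <= e) && btw e x y z.
Proof.
rewrite /Mdist /btw !ge_max; congr andb; rewrite andbC; congr andb.
  by rewrite lerBlDr -lerBlDl le_max !lerBlDr.
by rewrite lerBlDl ge_min -!lerBlDr.
Qed.

Lemma btwN e x y z : btw e (- x) (- y) (- z) = btw e x y z.
Proof.
rewrite /btw andbC; congr andb; congr orb;
  by apply/idP/idP; lra.
Qed.

End Betweenness.

(** * The modulus [w_M] and the completed graph *)

Section Modulus.
Context {R : realType}.
Implicit Types (f h : R -> R) (x y z t d e dl eta : R).

(** A failure at [eta] is a strict inequality and persists after half of the smaller gap is added.
    One-sided limits can therefore be replaced by nearby values at a cost [e]. *)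
Lemma btw_closed eta x y z : (forall e, 0 < e -> btw (eta + e) x y z) ->
  btw eta x y z.
Proof.
move=> H; apply/negPn/negP; rewrite /btw negb_and => /orP[].
  rewrite negb_or -!ltNge => /andP[a b].
  have := H (Num.min (y - x - eta) (y - z - eta) / 2).
  rewrite divr_gt0 ?lt_min //; last by rewrite !subr_gt0; apply/andP; split; lra.
  move=> /(_ isT) /andP[+ _] => /orP.
  have : Num.min (y - x - eta) (y - z - eta) <= y - x - eta by rewrite ge_min lexx.
  have : Num.min (y - x - eta) (y - z - eta) <= y - z - eta.
    by rewrite ge_min lexx orbT.
  by move=> ? ? []; lra.
rewrite negb_or -!ltNge => /andP[a b].
have := H (Num.min (x - y - eta) (z - y - eta) / 2).
rewrite divr_gt0 ?lt_min //; last by rewrite !subr_gt0; apply/andP; split; lra.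
move=> /(_ isT) /andP[_ +] => /orP.
have : Num.min (x - y - eta) (z - y - eta) <= x - y - eta by rewrite ge_min lexx.
have : Num.min (x - y - eta) (z - y - eta) <= z - y - eta.
  by rewrite ge_min lexx orbT.
by move=> ? ? []; lra.
Qed.

Lemma btw_near eta e x y z x' y' z' : `|x' - x| < e / 2 -> `|y' - y| < e / 2 ->
  `|z' - z| < e / 2 -> btw eta x' y' z' -> btw (eta + e) x y z.
Proof.
rewrite !ltr_norml => /andP[? ?] /andP[? ?] /andP[? ?].
by move=> /andP[/orP[?|?] /orP[?|?]]; apply/andP; split; apply/orP;
  solve [left; lra | right; lra].
Qed.

Lemma btw_refll eta x z : 0 <= eta -> btw eta x x z.
Proof. by move=> e0; apply/andP; split; apply/orP; left; lra. Qed.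

Lemma btw_reflr eta x z : 0 <= eta -> btw eta x z z.
Proof. by move=> e0; apply/andP; split; apply/orP; right; lra. Qed.

(** An oscillation bound that involves only values at three strictly ordered times of the whole
    line. Without left limits it passes to pointwise limits. *)
Definition modulus h dl eta := forall s1 s2 s3, s1 < s2 -> s2 < s3 ->
  s3 - s1 < dl -> btw eta (h s1) (h s2) (h s3).

(** The oscillation [wM] sees the first time only through a left limit. By right continuity the left
    limit slightly after [s1] is close to the value at [s1]; the middle time is shifted right so as
    to come after that point. *)
Lemma modulus_ext f dl eta : 0 <= eta -> cadlag f ->
  (wM f dl <= eta%:E)%E -> modulus (ext f) dl eta.
Proof.
move=> eta0 cf wf s1 s2 s3 s12 s23 s13.
have W t1 t t2 : 0 <= t1 -> t1 < t -> t < t2 -> t2 <= 1 -> t2 - t1 < dl ->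
    btw eta (leftlim f t1) (ext f t) (ext f t2).
  move=> t10 t1t tt2 t21 td; rewrite !ext01; try lra.
  suff : Mdist (leftlim f t1) (f t) (f t2) <= eta by rewrite Mdist_le => /andP[].
  rewrite -lee_fin; apply: le_trans wf; apply: ereal_sup_ubound.
  exists t1, t, t2; split => //; [by rewrite t10|by rewrite tt2|].
  by rewrite ger0_norm; lra.
have [s20|s20] := ltP s2 0.
  by rewrite (ext_lt0 f s20) ext_lt0 ?btw_refll//; lra.
have [s21|s21] := leP 1 s2.
  by rewrite (ext_ge1 f s21) (@ext_ge1 _ f s3) ?btw_reflr//; lra.
apply: btw_closed => e e0; have e20 : 0 < e / 2 by lra.
(* Times beyond [1] are brought back to [1], where [ext f] has the same value. *)
have [u3 [u3l u3r u3s u3E]] : exists u3, [/\ s2 < u3, u3 <= 1, u3 <= s3 &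
    ext f u3 = ext f s3].
  have [s31|s31] := ltP s3 1; first by exists s3; split => //; lra.
  by exists 1; split => //; rewrite !ext_ge1.
have [d2 d20 Hd2] := ext_right s2 cf e20.
have [u2 [u2l u2r u2E]] : exists u2, [/\ s2 < u2, u2 < u3 &
    `|ext f u2 - ext f s2| < e / 2].
  exists (Num.min (s2 + d2 / 2) ((s2 + u3) / 2)).
  have : Num.min (s2 + d2 / 2) ((s2 + u3) / 2) <= s2 + d2 / 2 by rewrite ge_min lexx.
  have : Num.min (s2 + d2 / 2) ((s2 + u3) / 2) <= (s2 + u3) / 2
    by rewrite ge_min lexx orbT.
  have : s2 < Num.min (s2 + d2 / 2) ((s2 + u3) / 2) by rewrite lt_min; apply/andP; split; lra.
  by move=> *; split => //; [|apply: Hd2 => //]; lra.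
have [u1 [u1l u1r u1s u1E]] : exists u1, [/\ 0 <= u1, u1 < u2, s1 <= u1 &
    `|leftlim f u1 - ext f s1| < e / 2].
  have [s10|s10] := ltP s1 0.
    exists 0; split => //; try lra.
    by rewrite ext_lt0 // /leftlim lexx subrr normr0.
  have e40 : 0 < e / 4 by lra.
  have [d1 d10 Hd1] := ext_right s1 cf e40.
  set u1 := Num.min (s1 + d1 / 2) s2.
  have u1a : u1 <= s1 + d1 / 2 by rewrite ge_min lexx.
  have u1b : u1 <= s2 by rewrite ge_min lexx orbT.
  have u1c : s1 < u1 by rewrite lt_min; apply/andP; split; lra.
  exists u1; split; [lra..|].
  have u101 : 0 <= u1 <= 1 by apply/andP; split; lra.
  have [d d0 Hd] := ext_left cf u101 e40.
  set v := Num.max ((u1 + s1) / 2) (u1 - d / 2).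
  have va : (u1 + s1) / 2 <= v by rewrite le_max lexx.
  have vb : u1 - d / 2 <= v by rewrite le_max lexx orbT.
  have vc : v < u1 by rewrite gt_max; apply/andP; split; lra.
  have : `|ext f v - leftlim f u1| < e / 4 by apply: Hd; lra.
  have : `|ext f v - ext f s1| < e / 4 by apply: Hd1; lra.
  by rewrite !ltr_norml => /andP[? ?] /andP[? ?]; apply/andP; split; lra.
apply: (btw_near u1E u2E _ (W u1 u2 u3 _ _ _ _ _)) => //; try lra.
by rewrite u3E subrr normr0.
Qed.

(* The two endpoints of the vertical segment of the completed graph at [t], in the
   order in which they are visited; [slex] is this order on the pairs [(t, b)]. *)
Definition side f t (b : bool) := if b then ext f t else leftlim f t.

Lemma side_approx f t b : cadlag f -> 0 <= t <= 1 -> forall e d, 0 < e -> 0 < d ->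
  exists s, [/\ t - d < s, (if b then s = t else s < t)
     & `|ext f s - side f t b| < e].
Proof.
move=> cf t01 e d e0 d0; case: b => /=.
  by exists t; split => //; [lra|rewrite subrr normr0].
have [d' d'0 H] := ext_left cf t01 e0.
have dd : 0 < Num.min d d' by rewrite lt_min d0.
have da : Num.min d d' <= d by rewrite ge_min lexx.
have db : Num.min d d' <= d' by rewrite ge_min lexx orbT.
by exists (t - Num.min d d' / 2); split; [lra|lra|apply: H; lra].
Qed.

Definition slex (t : R) (b : bool) (t' : R) (b' : bool) :=
  t < t' \/ t = t' /\ (b ==> b').

Lemma slex_eqVlt t b t' b' : slex t b t' b' ->
  (t = t' /\ b = b') \/ (t < t' \/ [/\ t = t', ~~ b & b']).
Proof.
by case=> [|[-> +]]; [auto|case: b; case: b' => //=; auto; right; right].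
Qed.

(** Each endpoint is approximated by a value of [ext f] at a time not after it, strictly before it
    for a left limit. The tolerances keep the three times strictly ordered and their span below
    [dl]; coinciding neighbours are trivial. *)
Lemma side_modulus f dl eta t1 b1 t2 b2 t3 b3 : cadlag f -> 0 <= eta ->
  modulus (ext f) dl eta -> 0 <= t1 <= 1 -> 0 <= t2 <= 1 -> 0 <= t3 <= 1 ->
  slex t1 b1 t2 b2 -> slex t2 b2 t3 b3 -> t3 - t1 < dl ->
  btw eta (side f t1 b1) (side f t2 b2) (side f t3 b3).
Proof.
move=> cf eta0 mf t101 t201 t301 L12 L23 span.
have [[-> ->]|N12] := slex_eqVlt L12; first exact: btw_refll.
have [[-> ->]|N23] := slex_eqVlt L23; first exact: btw_reflr.
apply: btw_closed => e e0; have e20 : 0 < e / 2 by lra.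
have gap0 : 0 < dl - (t3 - t1) by lra.
have [s1 [s1a s1b s1E]] := side_approx b1 cf t101 e20 gap0.
(* The tolerance [t2 - t1] keeps [s2] after [t1]. When [t1 = t2] the two sides are the left limit
   and the value, which orders the times by itself, and [1] is arbitrary. *)
have g2 : 0 < if t1 < t2 then t2 - t1 else 1 by case: ifPn => *; lra.
have [s2 [s2a s2b s2E]] := side_approx b2 cf t201 e20 g2.
have g3 : 0 < if t2 < t3 then t3 - t2 else 1 by case: ifPn => *; lra.
have [s3 [s3a s3b s3E]] := side_approx b3 cf t301 e20 g3.
have le_of b (s t : R) : (if b then s = t else s < t) -> s <= t.
  by case: b => [->|/ltW].
move: (le_of _ _ _ s1b) (le_of _ _ _ s2b) (le_of _ _ _ s3b) => s1t s2t s3t.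
apply: (btw_near s1E s2E s3E); apply: mf; last lra.
- case: N12 => [t12|[t12 nb1 Hb2]]; first by rewrite t12 in s2a; lra.
  by rewrite (negPf nb1) in s1b; rewrite Hb2 in s2b; lra.
- case: N23 => [t23|[t23 nb2 Hb3]]; first by rewrite t23 in s3a; lra.
  by rewrite (negPf nb2) in s2b; rewrite Hb3 in s3b; lra.
Qed.

End Modulus.

(** * The order along the completed graph *)

Section GraphOrder.
Context {R : realType}.
Implicit Types (f : R -> R) (p q z : R * R).

Lemma Gamma0_bounds f p : Gamma0 f p -> 0 <= p.1 <= 1.
Proof. by case=> *; apply/andP. Qed.

Lemma Gamma0P f p : Gamma0 f p -> 0 <= p.1 <= 1 /\
  ((leftlim f p.1 <= p.2 <= f p.1) \/ (f p.1 <= p.2 <= leftlim f p.1)).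
Proof.
case=> a b c d; split; first by rewrite a.
move: c d; rewrite ge_min le_max => /orP[] c /orP[] d.
- have [?|/ltW ?] := leP (leftlim f p.1) (f p.1).
    by left; rewrite c (le_trans d).
  by right; rewrite d andbT; apply: le_trans c.
- by left; apply/andP.
- by right; apply/andP.
- have [?|/ltW ?] := leP (leftlim f p.1) (f p.1).
    by left; rewrite d andbT; apply: le_trans c.
  by right; rewrite c (le_trans d).
Qed.

Lemma Gamma0I f t x : 0 <= t <= 1 ->
  (leftlim f t <= x <= f t) \/ (f t <= x <= leftlim f t) -> Gamma0 f (t, x).
Proof.
move=> /andP[a b] H; split => //=; rewrite ?ge_min ?le_max.
  by case: H => /andP[-> _]//; rewrite orbT.
by case: H => /andP[_ ->]//; rewrite orbT.
Qed.

Definition graph_lt f p q : Prop :=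
  p.1 < q.1 \/ p.1 = q.1 /\ `|p.2 - leftlim f p.1| < `|q.2 - leftlim f p.1|.

Lemma graph_ltW f p q : graph_lt f p q -> graph_le f p q.
Proof. by case=> [|[? ?]]; [left|right; split => //; apply: ltW]. Qed.

Lemma graph_le_refl f p : graph_le f p p.
Proof. by right. Qed.

Lemma graph_le_trans f p q z : graph_le f p q -> graph_le f q z -> graph_le f p z.
Proof.
case=> [a|[a b]] [c|[c d]].
- by left; apply: lt_trans c.
- by left; rewrite -c.
- by left; rewrite a.
- by right; rewrite a -c; split; [by []|rewrite a in b; exact: le_trans d].
Qed.

Lemma graph_le_lt_trans f p q z :
  graph_le f p q -> graph_lt f q z -> graph_lt f p z.
Proof.
case=> [a|[a b]] [c|[c d]].
- by left; apply: lt_trans c.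
- by left; rewrite -c.
- by left; rewrite a.
- by right; rewrite a -c; split; [by []|rewrite a in b; exact: le_lt_trans d].
Qed.

Lemma graph_lt_le_trans f p q z :
  graph_lt f p q -> graph_le f q z -> graph_lt f p z.
Proof.
case=> [a|[a b]] [c|[c d]].
- by left; apply: lt_trans c.
- by left; rewrite -c.
- by left; rewrite a.
- by right; rewrite a -c; split; [by []|rewrite a in b; exact: lt_le_trans d].
Qed.

Lemma graph_lt_irr f p : ~ graph_lt f p p.
Proof. by case=> [|[_]]; rewrite ltxx. Qed.

Lemma graph_le_total f p q : graph_le f p q \/ graph_lt f q p.
Proof.
have [a|a|a] := ltgtP p.1 q.1; [by left; left|by right; left|].
have [b|b] := leP (`|p.2 - leftlim f p.1|) (`|q.2 - leftlim f p.1|).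
  by left; right.
by right; right; rewrite -a.
Qed.

(** The order compares distances to the left limit. A vertical segment of the graph lies on one side
    of its left limit, so equal distances mean equal points. *)
Lemma graph_le_eqVlt f p q : Gamma0 f p -> Gamma0 f q -> graph_le f p q ->
  p = q \/ graph_lt f p q.
Proof.
move=> /Gamma0P[_ Gp] /Gamma0P[_ Gq] [|[E]]; first by right; left.
rewrite le_eqVlt => /orP[/eqP N|]; last by right; right.
left; case: p q E Gp Gq N => [t x] [t' y] /= <- Gp Gq /eqP.
by rewrite eqr_norm2 => /orP[] /eqP ?; congr pair;
  case: Gp Gq => /andP[? ?] [] /andP[? ?]; lra.
Qed.

Lemma leftlim0 f : leftlim f 0 = 0.
Proof. by rewrite /leftlim lexx. Qed.

Lemma Gamma0_start f : Gamma0 f (0, 0).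
Proof.
apply: Gamma0I; rewrite ?lexx ?ler01 // leftlim0.
by case/orP: (le_total 0 (f 0)) => h; [left|right]; rewrite h lexx. Qed.

Lemma Gamma0_value f t : 0 <= t <= 1 -> Gamma0 f (t, f t).
Proof.
move=> t01; apply: Gamma0I => //.
by case/orP: (le_total (leftlim f t) (f t)) => h; [left|right]; rewrite h lexx.
Qed.

Lemma graph_le_start f p : Gamma0 f p -> graph_le f (0, 0) p.
Proof.
move=> /Gamma0_bounds /andP[]; rewrite le_eqVlt => /orP[/eqP a _|a _].
  by right; rewrite /= leftlim0 subrr normr0.
by left.
Qed.

Lemma graph_le_end f p : Gamma0 f p -> graph_le f p (1, f 1).
Proof.
move=> /Gamma0P[/andP[_ +]]; rewrite le_eqVlt => /orP[/eqP a|a _].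
  rewrite a => H; right; rewrite /= a; split => //.
  by case: H => /andP[? ?]; [rewrite !ger0_norm|rewrite !ler0_norm]; lra.
by left.
Qed.

End GraphOrder.

Section Opposite.
Context {R : realType}.
Implicit Types (f : R -> R) (p q : R * R).

(** Reflection exchanges rising and falling arcs. It yields the lower half of the modulus estimate
    and the falling case of the intermediate value theorem. *)
Definition negp p : R * R := (p.1, - p.2).

Lemma negpK : involutive negp.
Proof. by case=> t x; rewrite /negp /= opprK. Qed.

Lemma cadlagN f : cadlag f -> cadlag (\- f).
Proof.
move=> [fr fl]; split=> t t0 t1; first exact: cvgN (fr t t0 t1).
exact: is_cvgN (fl t t0 t1).
Qed.

Lemma leftlimN f t : cadlag f -> t <= 1 -> leftlim (\- f) t = - leftlim f t.
Proof.
move=> [_ fl] t1; rewrite /leftlim; case: ifPn => [_|]; first by rewrite oppr0.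
rewrite -ltNge => t0; apply: cvg_lim => //; apply: cvgN.
exact: fl.
Qed.

Lemma extN f t : ext (\- f) t = - ext f t.
Proof. by rewrite /ext; case: ifPn; rewrite ?oppr0//; case: ifPn. Qed.

Lemma Gamma0N f p : cadlag f -> Gamma0 f p -> Gamma0 (\- f) (negp p).
Proof.
case: p => t x cf /Gamma0P[t01 H]; apply: Gamma0I => //=.
rewrite leftlimN //; last by case/andP: t01.
by rewrite /= !lerN2; case: H => /andP[a b]; [right|left]; rewrite /= in a b *; rewrite a b.
Qed.

Lemma graph_leN f p q : cadlag f -> p.1 <= 1 -> graph_le f p q ->
  graph_le (\- f) (negp p) (negp q).
Proof.
move=> cf p1 [|[E N]]; [by left|right; split => //=].
by rewrite leftlimN // -!opprD !normrN.
Qed.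

Lemma modulusN h (dl eta : R) : modulus h dl eta -> modulus (\- h) dl eta.
Proof. by move=> m s1 s2 s3 *; rewrite /= btwN; apply: m. Qed.

End Opposite.

(** * Modulus and intermediate values along the completed graph *)

Section GraphModulus.
Context {R : realType}.
Implicit Types (f : R -> R) (p q : R * R).

Lemma Gamma0_above f p : Gamma0 f p -> exists b, p.2 <= side f p.1 b.
Proof.
move=> /Gamma0P[p01]; rewrite /side => -[] /andP[? ?]; [exists true|by exists false].
by rewrite ext01.
Qed.

Lemma Gamma0_below f p : Gamma0 f p -> exists b, side f p.1 b <= p.2.
Proof.
move=> /Gamma0P[p01]; rewrite /side => -[] /andP[? ?]; [by exists false|exists true].
by rewrite ext01.
Qed.

(** A vertical segment is traversed away from its left limit, so one rise between two of its points
    shows that the whole segment runs upward. *)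
Lemma Gamma0_climb f p q : Gamma0 f p -> Gamma0 f q -> p.1 = q.1 ->
  graph_le f p q -> p.2 < q.2 ->
  side f p.1 false <= p.2 /\ q.2 <= side f q.1 true.
Proof.
case: p q => t x [t' y] /Gamma0P[t01 /= Gp] /Gamma0P[_ /= Gq] E; subst t'.
case=> /=; rewrite ?ltxx // => -[_ N] xy; rewrite ext01 //.
case: Gp => /andP[a b]; case: Gq => /andP[c e]; try by split => //; lra.
by move: N; rewrite !ler0_norm; lra.
Qed.

Lemma Gamma0_fall f p q : Gamma0 f p -> Gamma0 f q -> p.1 = q.1 ->
  graph_le f p q -> q.2 < p.2 ->
  p.2 <= side f p.1 false /\ side f q.1 true <= q.2.
Proof.
case: p q => t x [t' y] /Gamma0P[t01 /= Gp] /Gamma0P[_ /= Gq] E; subst t'.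
case=> /=; rewrite ?ltxx // => -[_ N] xy; rewrite ext01 //.
case: Gp => /andP[a b]; case: Gq => /andP[c e]; try by split => //; lra.
by move: N; rewrite !ger0_norm; lra.
Qed.

Lemma graph_le1 f p q : graph_le f p q -> p.1 < q.1 \/ p.1 = q.1.
Proof. by case=> [|[]]; auto. Qed.

(** If [p2] exceeded both others by more than [eta], replacing it by an upper end of its segment and
    [p1], [p3] by lower ends would contradict [side_modulus]. For points sharing a segment, its
    direction shows that these ends come in the right order. *)
Lemma graph_upper f (dl eta : R) p1 p2 p3 : cadlag f -> 0 <= eta ->
  modulus (ext f) dl eta -> Gamma0 f p1 -> Gamma0 f p2 -> Gamma0 f p3 ->
  graph_le f p1 p2 -> graph_le f p2 p3 -> p3.1 - p1.1 < dl ->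
  (p2.2 <= p1.2 + eta) || (p2.2 <= p3.2 + eta).
Proof.
move=> cf eta0 mf G1 G2 G3 L12 L23 span; apply/negPn/negP.
rewrite negb_or -!ltNge => /andP[x12 x32].
have [b1 [b2 [b3 [S12 S23 [Hb1 Hb2 Hb3]]]]] : exists b1 b2 b3,
    [/\ slex p1.1 b1 p2.1 b2, slex p2.1 b2 p3.1 b3 &
     [/\ side f p1.1 b1 <= p1.2, p2.2 <= side f p2.1 b2 & side f p3.1 b3 <= p3.2]].
  have [[b1 B1] [b2 B2] [b3 B3]] :=
    And3 (Gamma0_below G1) (Gamma0_above G2) (Gamma0_below G3).
  have [t12|t12] := graph_le1 L12; have [t23|t23] := graph_le1 L23.
  - by exists b1, b2, b3; split; [left|left|split].
  - have [B2' B3'] := Gamma0_fall G2 G3 t23 L23 ltac:(lra).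
    by exists b1, false, true; split; [left|right|split].
  - have [B1' B2'] := Gamma0_climb G1 G2 t12 L12 ltac:(lra).
    by exists false, true, b3; split; [right|left|split].
  (* All three points lie on one segment, which cannot both rise and fall. *)
  - have [B2' B3'] := Gamma0_fall G2 G3 t23 L23 ltac:(lra).
    have [B1' B2''] := Gamma0_climb G1 G2 t12 L12 ltac:(lra).
    by exfalso; rewrite t12 in B1'; rewrite -t23 in B3'; lra.
have /andP[/orP[]] := side_modulus cf eta0 mf (Gamma0_bounds G1)
  (Gamma0_bounds G2) (Gamma0_bounds G3) S12 S23 span; lra.
Qed.

Lemma graph_modulus f (dl eta : R) p1 p2 p3 : cadlag f -> 0 <= eta ->
  modulus (ext f) dl eta -> Gamma0 f p1 -> Gamma0 f p2 -> Gamma0 f p3 ->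
  graph_le f p1 p2 -> graph_le f p2 p3 -> p3.1 - p1.1 < dl ->
  btw eta p1.2 p2.2 p3.2.
Proof.
move=> cf eta0 mf G1 G2 G3 L12 L23 span; apply/andP; split.
  exact: graph_upper L12 L23 span.
have mN : modulus (ext (\- f)) dl eta.
  by rewrite (_ : ext _ = \- ext f); [exact: modulusN|apply/funext => t; rewrite extN].
have [/andP[_ ?] /andP[_ ?]] := conj (Gamma0_bounds G1) (Gamma0_bounds G2).
have := graph_upper (cadlagN cf) eta0 mN (Gamma0N cf G1) (Gamma0N cf G2)
  (Gamma0N cf G3) (graph_leN cf _ L12) (graph_leN cf _ L23) span.
by move=> /(_ ltac:(done) ltac:(done)) /= /orP[]?; apply/orP; [left|right]; lra.
Qed.

(** Vertical segments fill the jumps. If [l] is not reached over the time of [p] or of [q], it is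
    reached over the supremum [t] of the intermediate times where [f] is at most [l]. *)
Lemma graph_IVT_up f p q l : cadlag f -> Gamma0 f p -> Gamma0 f q ->
  graph_le f p q -> p.2 <= l <= q.2 ->
  exists y, [/\ Gamma0 f y, graph_le f p y, graph_le f y q & y.2 = l].
Proof.
move=> cf Gp Gq pq /andP[pl lq].
have p01 := Gamma0_bounds Gp; have q01 := Gamma0_bounds Gq.
have [t12|t12] := graph_le1 pq; last first.
  have [plq|] := ltP p.2 q.2; last first.
    move=> qp; exists p; split => //; last lra.
    exact: graph_le_refl.
  have [a b] := Gamma0_climb Gp Gq t12 pq plq.
  move: a b; rewrite /= -t12 ext01 // => a b.
  exists (p.1, l); split; last by [].
  - by apply: Gamma0I => //; left; apply/andP; split; lra.
  - by right; split => //=; rewrite !ger0_norm; lra.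
  - by right; split => //=; rewrite !ger0_norm; lra.
have [lf|fl] := leP l (f p.1).
  exists (p.1, l); split; [| |by left|by []].
    have [/= _ H] := Gamma0P Gp.
    apply: Gamma0I => //; case: H => /andP[a b]; [left|right]; apply/andP; split; lra.
  right; split => //=; have [_ [/andP[a b]|/andP[a b]]] := Gamma0P Gp.
    by rewrite !ger0_norm; lra.
  by have -> : l = p.2 by lra.
have [ll|ll] := leP (leftlim f q.1) l.
  exists (q.1, l); split; [|by left| |by []]; last first.
  - right; split => //=; have [_ [/andP[a b]|/andP[a b]]] := Gamma0P Gq.
      by rewrite !ger0_norm; lra.
    by have -> : l = q.2 by lra.
  - have [/= _ H] := Gamma0P Gq.
    by apply: Gamma0I => //; case: H => /andP[a b]; [left|right]; apply/andP; split; lra.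
pose A := [set s | p.1 <= s < q.1 /\ f s <= l].
have Ap : A p.1 by split; [rewrite lexx|apply: ltW].
have supA : has_sup A.
  by split; [exists p.1|exists q.1 => s [/andP[_ /ltW]]].
set t := sup A.
have pt : p.1 <= t by apply: (ub_le_sup supA.2 Ap).
have tub s : A s -> s <= t by move=> As; apply: (ub_le_sup supA.2 As).
have tq : t < q.1.
  have [d d0 Hd] := ext_left cf q01 (e := leftlim f q.1 - l) ltac:(lra).
  rewrite ltNge; apply/negP => qt.
  have [s As] := sup_adherent d0 supA; rewrite -/t => ts.
  have [/andP[ps sq] fsl] := As.
  have : `|ext f s - leftlim f q.1| < leftlim f q.1 - l by apply: Hd => //; lra.
  by rewrite ext01 ?ltr_norml; [move=> /andP[]; lra|lra].
have t01 : 0 <= t <= 1 by lra.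
have lft : l <= f t.
  rewrite leNgt; apply/negP => ftl.
  have [d d0 Hd] := ext_right t cf (e := l - f t) ltac:(lra).
  pose u := Num.min (t + d / 2) ((t + q.1) / 2).
  have ua : u <= t + d / 2 by rewrite ge_min lexx.
  have ub : u <= (t + q.1) / 2 by rewrite ge_min lexx orbT.
  have uc : t < u by rewrite lt_min; apply/andP; split; lra.
  have : `|ext f u - ext f t| < l - f t by apply: Hd; lra.
  rewrite !ext01 ?ltr_norml; [|lra..] => /andP[_ fu].
  have := tub u; rewrite /A /= => /(_ ltac:(split; [apply/andP; split|]; lra)); lra.
(* If the supremum is attained then [f t = l]. Otherwise times of [A] accumulate at [t] from the
   left and put the left limit at or below [l]. *)
have [At|nAt] := pselect (A t).
  exists (t, l); split; [| |by left|by []].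
    have E : f t = l by case: At => _ ?; lra.
    by rewrite -E; apply: Gamma0_value.
  move: pt; rewrite le_eqVlt => /orP[/eqP E|]; last by left.
  by move: lft; rewrite -E; lra.
have lt : leftlim f t <= l.
  rewrite leNgt; apply/negP => ltl.
  have [d d0 Hd] := ext_left cf t01 (e := leftlim f t - l) ltac:(lra).
  have [s As] := sup_adherent d0 supA; rewrite -/t => ts.
  have [/andP[ps sq] fsl] := As.
  have st : s < t.
    rewrite lt_neqAle tub // andbT; apply/eqP => E; apply: nAt; rewrite -E //.
  have : `|ext f s - leftlim f t| < leftlim f t - l by apply: Hd => //; lra.
  by rewrite ext01 ?ltr_norml; [move=> /andP[]; lra|lra].
exists (t, l); split; [| |by left|by []].
  by apply: Gamma0I => //; left; rewrite lt.
left; rewrite /= lt_neqAle pt andbT; apply/eqP => E; apply: nAt; rewrite -E //.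
Qed.

Lemma graph_IVT f p q l : cadlag f -> Gamma0 f p -> Gamma0 f q ->
  graph_le f p q -> (p.2 <= l <= q.2) \/ (q.2 <= l <= p.2) ->
  exists y, [/\ Gamma0 f y, graph_le f p y, graph_le f y q & y.2 = l].
Proof.
move=> cf Gp Gq pq [|/andP[ql lp]]; first exact: graph_IVT_up.
have /andP[_ p1] := Gamma0_bounds Gp.
have [//|y [Gy py yq yl]] := graph_IVT_up (l := - l) (cadlagN cf)
  (Gamma0N cf Gp) (Gamma0N cf Gq) (graph_leN cf p1 pq).
  by rewrite /= !lerN2 lp.
have fNN : \- (\- f) = f by apply/funext => t /=; rewrite opprK.
have /andP[_ y1] := Gamma0_bounds Gy.
have cN := cadlagN cf.
exists (negp y); split; last by rewrite /= yl opprK.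
- by rewrite -fNN; apply: Gamma0N.
- by rewrite -fNN -[p]negpK; apply: graph_leN.
- by rewrite -fNN -[q]negpK; apply: graph_leN.
Qed.

End GraphModulus.

(** * Parametrizations of the completed graph *)

Section BinaryWeights.
Context {R : realType}.
Implicit Types (S : set nat).

Definition wsum S (m : nat) : R :=
  \sum_(i < m) if `[< S i >] then 2^-1 ^+ i.+1 else 0.

(** The mass of [S] under the measure with mass [2^-(n+1)] at [n], taken as a supremum so that only
    boundedness has to be checked. *)
Definition weight S : R := sup (range (wsum S)).

Lemma half_gt0 n : 0 < 2^-1 ^+ n :> R.
Proof. by rewrite exprn_gt0 // invr_gt0. Qed.

(** Indices below [k] contribute no more to [S] than to [S'], and those from [k] to [m - 1]
    contribute at most the geometric sum [2^-k - 2^-m]. *)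
Lemma wsum_trunc S S' k : (forall n, (n < k)%N -> S n -> S' n) ->
  forall m, wsum S m <= wsum S' m + (if (k <= m)%N then 2^-1 ^+ k - 2^-1 ^+ m else 0).
Proof.
move=> H; elim=> [|m IH].
  by rewrite /wsum !big_ord0; case: k H => [|k] H /=; rewrite ?subrr addr0.
rewrite /wsum !big_ord_recr /= -!/(wsum _ _).
have := half_gt0 m; have := half_gt0 m.+1; have := half_gt0 k.
have E : 2^-1 ^+ m.+1 = 2^-1 ^+ m / 2 :> R by rewrite exprSr.
have [mk|km] := ltnP m k.
  move: IH; rewrite leqNgt mk /= addr0 => IH.
  have [kE|] := leqP k m.+1.
    have -> : k = m.+1 by lia.
    by case: asboolP => [/(H _ mk) ?|?]; case: asboolP => // *; rewrite ?E in IH *; lra.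
  by case: asboolP => [/(H _ mk) ?|?]; case: asboolP => // *; lra.
move: IH; rewrite km (leqW km) E => IH.
by case: ifPn; case: ifPn => *; lra.
Qed.

Lemma wsum_le1 S m : wsum S m <= 1.
Proof.
have := @wsum_trunc S set0 0 (fun n => fun A => False_ind _ (notF A)) m.
have -> : wsum set0 m = 0.
  by apply: big1 => i _; case: asboolP.
rewrite leq0n expr0; have := half_gt0 m; lra.
Qed.

Lemma has_sup_wsum S : has_sup (range (wsum S)).
Proof.
by split; [exists (wsum S 0), 0%N|exists 1 => _ [m _ <-]; exact: wsum_le1].
Qed.

Lemma wsum_weight S m : wsum S m <= weight S.
Proof. by apply: (ub_le_sup (has_sup_wsum S).2); exists m. Qed.

Lemma weight_ge S S' c : (forall m, exists m', wsum S m + c <= wsum S' m') ->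
  weight S + c <= weight S'.
Proof.
move=> H; rewrite -lerBrDr; apply: ge_sup; first by exists (wsum S 0), 0%N.
move=> _ [m _ <-]; have [m' Hm] := H m; have := wsum_weight S' m'; lra.
Qed.

Lemma weight_trunc S S' k : (forall n, (n < k)%N -> S n -> S' n) ->
  weight S <= weight S' + 2^-1 ^+ k.
Proof.
move=> H; rewrite -lerBlDr; apply: weight_ge => m; exists m.
have := wsum_trunc H m; have := half_gt0 m; have := half_gt0 k.
by case: ifPn => *; lra.
Qed.

Lemma weight_le S S' : S `<=` S' -> weight S <= weight S'.
Proof.
move=> H; rewrite -[leLHS]addr0; apply: weight_ge => m; exists m; rewrite addr0.
apply: ler_sum => i _; case: asboolP => [/H ?|_]; first by rewrite asboolT.
  by case: ifPn => // _; exact: ltW (half_gt0 _).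
Qed.

(** Every partial sum that includes the index [n] shows a gap of [2^-(n+1)], and this gap survives
    the supremum. *)
Lemma weight_lt S S' n : S `<=` S' -> S' n -> ~ S n -> weight S < weight S'.
Proof.
move=> H S'n Sn; have := half_gt0 n.+1; suff: weight S + 2^-1 ^+ n.+1 <= weight S' by lra.
have mono m : wsum S m <= wsum S' m.
  apply: ler_sum => i _; case: asboolP => [/H ?|_]; first by rewrite asboolT.
  by case: ifPn => // _; exact: ltW (half_gt0 _).
have inc m k : wsum S m <= wsum S (m + k).
  elim: k => [|k IH]; rewrite ?addn0 // addnS; apply: (le_trans IH).
  rewrite [leRHS]/wsum big_ord_recr /= lerDl; by case: asboolP.
have large k : wsum S (n.+1 + k) + 2^-1 ^+ n.+1 <= wsum S' (n.+1 + k).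
  elim: k => [|k IH].
    rewrite addn0 /wsum !big_ord_recr /= -!/(wsum _ _).
    by case: asboolP => // _; case: asboolP => // _; have := mono n; lra.
  rewrite addnS; move: (n.+1 + k)%N IH => l IH.
  rewrite /wsum !big_ord_recr /= -!/(wsum _ _); have := half_gt0 l.+1.
  by case: asboolP => [/H ?|?]; case: asboolP => // *; lra.
apply: weight_ge => m; exists (n.+1 + m)%N.
by apply: le_trans (large m); rewrite lerD2r addnC.
Qed.

End BinaryWeights.

(** * Coding of the jumps and a clock on the graph *)

Section JumpCodes.
Context {R : realType}.
Variable (f : R -> R).
Hypothesis cf : cadlag f.
Implicit Types (s t e : R) (n k : nat).

(* A jump across the rational level [a] is recorded by [a], its direction and
   a rational interval on which no other such crossing happens. *)
Definition crosses (c : rat * rat * rat * bool) t : Prop :=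
  let: (q, a, u, b) := c in
  [/\ ratr q < t, t < ratr u,
    (forall s, ratr q < s -> s < t -> if b then ext f s < ratr a else ratr a < ext f s) &
    (forall s, t <= s -> s < ratr u -> if b then ratr a < ext f s else ext f s < ratr a)].

(** At the midpoint of two such times [f] would lie strictly on both sides of the level. *)
Lemma crosses_unique c t t' : crosses c t -> crosses c t' -> t = t'.
Proof.
have lt_false t1 t2 : crosses c t1 -> crosses c t2 -> t1 < t2 -> False.
  case: c => [[[q a] u] b] [qt1 t1u _ H1] [_ t2u H2 _] t12.
  have := H1 ((t1 + t2) / 2) ltac:(lra) ltac:(lra).
  have := H2 ((t1 + t2) / 2) ltac:(lra) ltac:(lra).
  by case: b {H1 H2}; lra.
by move=> H H'; have [/(lt_false _ _ H H')|/(lt_false _ _ H' H)|] := ltgtP t t'.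
Qed.

Lemma crosses_jump c t : 0 <= t <= 1 -> crosses c t -> leftlim f t != f t.
Proof.
case: c => [[[q a] u] b] t01 [qt tu Hl Hr]; apply/eqP => E.
have := Hr t (lexx _) tu; rewrite ext01 //.
move=> Ht; have d0 : 0 < `|f t - ratr a|.
  by rewrite normr_gt0; case: b Ht {Hl Hr} => ?; lra.
have [d dgt H] := ext_left cf t01 d0.
set s := Num.max (t - d / 2) ((t + ratr q) / 2).
have sa : t - d / 2 <= s by rewrite le_max lexx.
have sb : (t + ratr q) / 2 <= s by rewrite le_max lexx orbT.
have st : s < t by rewrite gt_max; apply/andP; split; lra.
have := H s ltac:(lra) st; have := Hl s ltac:(lra) st; rewrite E ltr_norml.
case: b Ht {Hl Hr} => Ht Hs /andP[].
  by rewrite ger0_norm; lra.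
by rewrite ler0_norm; lra.
Qed.

Lemma crosses_exists t : 0 <= t <= 1 -> leftlim f t != f t -> exists c, crosses c t.
Proof.
move=> t01 J.
have [a Ha] : exists a : rat,
    (leftlim f t < ratr a < f t) || (f t < ratr a < leftlim f t).
  have [lt|lt|E] := ltgtP (leftlim f t) (f t); last by rewrite E eqxx in J.
  - by have [a] := rat_in_itvoo lt; rewrite in_itv /= => H; exists a; rewrite H.
  - by have [a] := rat_in_itvoo lt; rewrite in_itv /= => H; exists a; rewrite H orbT.
pose e := Num.min `|f t - ratr a| `|leftlim f t - ratr a|.
have e0 : 0 < e.
  by rewrite lt_min !normr_gt0; case/orP: Ha => /andP[? ?]; apply/andP; split; lra.
have ea : e <= `|f t - ratr a| by rewrite ge_min lexx.
have eb : e <= `|leftlim f t - ratr a| by rewrite ge_min lexx orbT.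
have [d1 d10 H1] := ext_left cf t01 e0.
have [d2 d20 H2] := ext_right t cf e0.
have [q] := @rat_in_itvoo R (t - d1) t ltac:(lra); rewrite in_itv /= => /andP[q1 q2].
have [u] := @rat_in_itvoo R t (t + d2) ltac:(lra); rewrite in_itv /= => /andP[u1 u2].
have H2' s : t <= s -> s < ratr u -> `|ext f s - f t| < e.
  rewrite le_eqVlt => /orP[/eqP <- _|ts su]; first by rewrite ext01 // subrr normr0.
  by rewrite -[f t]ext01 //; apply: H2; lra.
case/orP: Ha => /andP[a1 a2].
  exists (q, a, u, true); split => // s s1 s2.
    move: eb (H1 s ltac:(lra) s2); rewrite ler0_norm ?ltr_norml; [|lra].
    by move=> ? /andP[]; lra.
  move: ea (H2' s s1 s2); rewrite ger0_norm ?ltr_norml; [|lra].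
  by move=> ? /andP[]; lra.
exists (q, a, u, false); split => // s s1 s2.
  move: eb (H1 s ltac:(lra) s2); rewrite ger0_norm ?ltr_norml; [|lra].
  by move=> ? /andP[]; lra.
move: ea (H2' s s1 s2); rewrite ler0_norm ?ltr_norml; [|lra].
by move=> ? /andP[]; lra.
Qed.

Definition jump_code n s : Prop := 0 <= s <= 1 /\
  exists2 c : rat * rat * rat * bool, choice.unpickle n = Some c & crosses c s.

Lemma jump_code_unique n s s' : jump_code n s -> jump_code n s' -> s = s'.
Proof. by move=> [_ [c E C]] [_ [c']]; rewrite E => -[<-]; apply: crosses_unique. Qed.

Lemma jump_codeP s : 0 <= s <= 1 ->
  leftlim f s != f s <-> exists n, jump_code n s.
Proof.
move=> s01; split=> [/(crosses_exists s01)[c C]|[n [_ [c _]]]]; last exact: crosses_jump.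
by exists (choice.pickle c); split => //; exists c; rewrite ?choice.pickleK.
Qed.

(** The right- and left-continuous versions of an increasing function of time that jumps, within
    [[0, 1]], exactly where [f] does. A jump may have many codes, but a code never serves two
    jumps. *)
Definition jumps_upto t := weight (R := R) [set n | exists2 s, s <= t & jump_code n s].
Definition jumps_before t := weight (R := R) [set n | exists2 s, s < t & jump_code n s].

Lemma jumps_before_le t : jumps_before t <= jumps_upto t.
Proof. by apply: weight_le => n [s /ltW st H]; exists s. Qed.

Lemma jumps_upto_before t t' : t < t' -> jumps_upto t <= jumps_before t'.
Proof. by move=> tt; apply: weight_le => n [s st H]; exists s => //; apply: le_lt_trans tt. Qed.

Lemma jumps_before_lt t : 0 <= t <= 1 -> leftlim f t != f t ->
  jumps_before t < jumps_upto t.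
Proof.
move=> t01 /(jump_codeP t01)[n Hn]; apply: (weight_lt (n := n)).
- by move=> m [s /ltW st H]; exists s.
- by exists t.
- by case=> s st /(jump_code_unique Hn) E; rewrite E ltxx in st.
Qed.

Lemma jumps_before_eq t : 0 <= t <= 1 -> leftlim f t = f t ->
  jumps_before t = jumps_upto t.
Proof.
move=> t01 E; apply/eqP; rewrite eq_le jumps_before_le /=.
apply: weight_le => n [s]; rewrite le_eqVlt => /orP[/eqP -> H|st H]; last by exists s.
by have := (jump_codeP t01).2 (ex_intro _ n H); rewrite E eqxx.
Qed.

Lemma half_small e : 0 < e -> exists k, 2^-1 ^+ k < e :> R.
Proof.
move=> e0; have := @cvg_geometric R 1 2^-1 ltac:(rewrite ger0_norm; lra).
move=> /cvgrPdist_lt/(_ _ e0)[k _ /(_ k (leqnn k))] /=; rewrite mul1r sub0r normrN.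
by rewrite ger0_norm ?exprn_ge0 ?invr_ge0 //; exists k.
Qed.

(** Codes from [k] on weigh at most [2^-k], and the finitely many smaller codes used before [t] are
    all used before some common [s < t]. *)
Lemma jumps_before_left t e : 0 < t -> 0 < e ->
  exists s, [/\ 0 <= s, s < t & jumps_before t <= jumps_before s + e].
Proof.
move=> t0 e0; have [k ke] := half_small e0.
suff [s [s0 st H]] : exists s, [/\ 0 <= s, s < t & forall n, (n < k)%N ->
    (exists2 u, u < t & jump_code n u) -> exists2 u, u < s & jump_code n u].
  by exists s; split => //; apply: le_trans (weight_trunc H) _; rewrite lerD2l ltW.
elim: {ke} k => [|k [s [s0 st H]]]; first by exists 0.
have [[u ut Hu]|N] := pselect (exists2 u, u < t & jump_code k u); last first.
  by exists s; split => // n; rewrite ltnS leq_eqVlt => /orP[/eqP -> //|/H].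
exists (Num.max s ((u + t) / 2)); split.
- by rewrite le_max s0.
- by rewrite gt_max st /=; lra.
- move=> n; rewrite ltnS leq_eqVlt => /orP[/eqP -> _|nk /(H n nk) [v vs Hv]].
    by exists u => //; rewrite lt_max; apply/orP; right; lra.
  by exists v => //; rewrite lt_max vs.
Qed.

(** The same truncation from the right: as a code belongs to a single time, taking [s] at most that
    time excludes it from the interval after [t]. *)
Lemma jumps_upto_right t e : t < 1 -> 0 < e ->
  exists s, [/\ s <= 1, t < s & jumps_before s <= jumps_upto t + e].
Proof.
move=> t1 e0; have [k ke] := half_small e0.
suff [s [s1 ts H]] : exists s, [/\ s <= 1, t < s & forall n, (n < k)%N ->
    (exists2 u, u < s & jump_code n u) -> exists2 u, u <= t & jump_code n u].
  by exists s; split => //; apply: le_trans (weight_trunc H) _; rewrite lerD2l ltW.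
elim: {ke} k => [|k [s [s1 ts H]]]; first by exists 1.
have [[u tu Hu]|N] := pselect (exists2 u, t < u & jump_code k u).
  exists (Num.min s u); split; rewrite ?ge_min ?lt_min ?s1 ?ts //.
  move=> n; rewrite ltnS leq_eqVlt => /orP[/eqP -> [v]|nk [v vs Hv]].
    rewrite lt_min => /andP[_ vu] /(jump_code_unique Hu) E.
    by rewrite E ltxx in vu.
  by apply: H => //; exists v => //; move: vs; rewrite lt_min => /andP[].
exists s; split => // n; rewrite ltnS leq_eqVlt => /orP[/eqP -> [v vs Hv]|/H //].
have [vt|tv] := leP v t; first by exists v.
by case: N; exists v.
Qed.

(* Junk value: [height p = 0 / 0 = 0] where [f] does not jump, which is harmless as
   [jumps_upto - jumps_before] vanishes there. *)
Definition height p : R := `|p.2 - leftlim f p.1| / `|f p.1 - leftlim f p.1|.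

(** Time plus accumulated jump weight, the weight of a jump being spread over its vertical segment
    in proportion to height. This increases strictly along the graph and leaves no gap in its
    range. *)
Definition clock (p : R * R) : R :=
  p.1 + jumps_before p.1 + (jumps_upto p.1 - jumps_before p.1) * height p.

Lemma height_ge0 p : 0 <= height p.
Proof. by rewrite divr_ge0. Qed.

Lemma height_le1 p : Gamma0 f p -> height p <= 1.
Proof.
move=> /Gamma0P[_ H]; rewrite /height.
have [->|N] := eqVneq (f p.1) (leftlim f p.1); first by rewrite subrr normr0 invr0 mulr0.
rewrite ler_pdivrMr ?normr_gt0 ?subr_eq0 // mul1r.
by case: H => /andP[a b]; [rewrite !ger0_norm|rewrite !ler0_norm]; lra.
Qed.

Lemma clock_mono p q : Gamma0 f p -> Gamma0 f q -> graph_lt f p q -> clock p < clock q.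
Proof.
move=> Gp Gq [lt|[E N]]; rewrite /clock.
  have a : (jumps_upto p.1 - jumps_before p.1) * height p <= jumps_upto p.1 - jumps_before p.1.
    by rewrite ler_piMr ?subr_ge0 ?jumps_before_le ?height_le1.
  have b : 0 <= (jumps_upto q.1 - jumps_before q.1) * height q.
    by rewrite mulr_ge0 ?subr_ge0 ?jumps_before_le ?height_ge0.
  move: (jumps_upto_before lt) a b; move: (_ * height p) (_ * height q) => x y.
  move: (jumps_upto p.1) (jumps_before p.1) (jumps_before q.1) => *; lra.
have [p01 Hp] := Gamma0P Gp; have [_ Hq] := Gamma0P Gq; rewrite -E in Hq.
rewrite /height -E ltrD2l.
have J : leftlim f p.1 != f p.1.
  apply/eqP => EE; rewrite -EE in Hp Hq.
  by move: N; rewrite (_ : p.2 = q.2) ?ltxx //; lra.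
rewrite ltr_pM2l ?subr_gt0 ?jumps_before_lt // ltr_pM2r // invr_gt0 normr_gt0.
by rewrite subr_eq0 eq_sym.
Qed.

(** Let [t] be the supremum of the times [s] with [s + jumps_before s <= r]. One-sided continuity of
    the jump functions places [r] between the clock values at the two ends of the segment over [t],
    and the clock is affine there. *)
Lemma clock_onto r : clock (0, 0) <= r <= clock (1, f 1) ->
  exists2 p, Gamma0 f p & clock p = r.
Proof.
have -> : clock (0, 0) = jumps_before 0.
  by rewrite /clock /height /= leftlim0 subrr normr0 mul0r mulr0 addr0 add0r.
have c1 : clock (1, f 1) <= 1 + jumps_upto 1.
  have one01 : 0 <= (1 : R) <= 1 by rewrite ler01 lexx.
  have := height_le1 (Gamma0_value f one01).
  rewrite /clock /=; have := jumps_before_le 1; set j := _ - _; set h := height _.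
  move=> jj h1; have : j * h <= j by rewrite ler_piMr // subr_ge0.
  by rewrite /j; lra.
move=> /andP[r0 r1]; have {c1}r1 := le_trans r1 c1.
pose A := [set s | 0 <= s <= 1 /\ s + jumps_before s <= r].
have A0 : A 0 by split; [rewrite lexx ler01|rewrite add0r].
have supA : has_sup A by split; [exists 0|exists 1 => s [/andP[]]].
set t := sup A.
have t0 : 0 <= t by apply: (ub_le_sup supA.2 A0).
have t1 : t <= 1 by apply: ge_sup; [exists 0|move=> s [/andP[]]].
have tub s : A s -> s <= t by move=> As; apply: (ub_le_sup supA.2 As).
have t01 : 0 <= t <= 1 by rewrite t0.
have lo : t + jumps_before t <= r.
  have [/eqP <-|tgt] := boolP (0 == t); first by rewrite add0r.
  apply/ler_addgt0Pr => e e0; have e20 : 0 < e / 2 by lra.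
  have [s [s0 st Hs]] := jumps_before_left (t := t) ltac:(by rewrite lt_def eq_sym tgt) e20.
  have m0 : 0 < Num.min (t - s) (e / 2) by rewrite lt_min subr_gt0 st.
  have [u Au] := sup_adherent m0 supA; rewrite -/t => ut.
  have ma : Num.min (t - s) (e / 2) <= t - s by rewrite ge_min lexx.
  have mb : Num.min (t - s) (e / 2) <= e / 2 by rewrite ge_min lexx orbT.
  have su : s < u by lra.
  have := le_trans (jumps_before_le s) (jumps_upto_before su).
  by case: Au; lra.
have hi : r <= t + jumps_upto t.
  have [tE|tlt] := eqVneq t 1; first by rewrite tE.
  have {}tlt : t < 1 by rewrite lt_neqAle tlt.
  apply/ler_addgt0Pr => e e0; have e20 : 0 < e / 2 by lra.
  have [s [s1 ts Hs]] := jumps_upto_right tlt e20.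
  pose v := Num.min s (t + e / 2).
  have va : v <= s by rewrite ge_min lexx.
  have vb : v <= t + e / 2 by rewrite ge_min lexx orbT.
  have vc : t < v by rewrite lt_min ts /=; lra.
  have Jv : jumps_before v <= jumps_before s.
    move: va; rewrite le_eqVlt => /orP[/eqP -> //|va].
    exact: le_trans (jumps_before_le v) (jumps_upto_before va).
  rewrite leNgt; apply/negP => rgt; have := tub v.
  by rewrite /A /= => /(_ ltac:(split; [apply/andP; split|]; lra)); lra.
have [E|J] := eqVneq (leftlim f t) (f t).
  exists (t, f t); first exact: Gamma0_value.
  by rewrite /clock /= -(jumps_before_eq t01 E) in hi *; lra.
have Jlt := jumps_before_lt t01 J.
set D := jumps_upto t - jumps_before t.
have D0 : 0 < D by rewrite subr_gt0.
set y := (r - t - jumps_before t) / D.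
have y0 : 0 <= y by rewrite divr_ge0 ?(ltW D0) //; lra.
have y1 : y <= 1 by rewrite ler_pdivrMr // mul1r /D; lra.
exists (t, leftlim f t + y * (f t - leftlim f t)).
  apply: Gamma0I => //; have [lf|/ltW lf] := leP (leftlim f t) (f t); [left|right].
    have : 0 <= y * (f t - leftlim f t) by rewrite mulr_ge0 ?subr_ge0.
    have : y * (f t - leftlim f t) <= f t - leftlim f t by rewrite ler_piMl ?subr_ge0.
    by move=> *; apply/andP; split; lra.
  have : 0 <= y * (leftlim f t - f t) by rewrite mulr_ge0 ?subr_ge0.
  have : y * (leftlim f t - f t) <= leftlim f t - f t by rewrite ler_piMl ?subr_ge0.
  by move=> *; apply/andP; split; lra.
rewrite /clock /height /= -/D [leftlim f t + _]addrC addrK normrM (ger0_norm y0).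
rewrite mulfK ?normr_eq0 ?subr_eq0 1?eq_sym // /y mulrC divfK ?gt_eqF //; lra.
Qed.

(** The parametrization is the inverse of [C] with its range rescaled to [[0, 1]]; strict
    monotonicity of [C] and totality of the order make it increasing. *)
Lemma Pi_of_clock (C : R * R -> R) :
  (forall p q, Gamma0 f p -> Gamma0 f q -> graph_lt f p q -> C p < C q) ->
  (forall r, C (0, 0) <= r <= C (1, f 1) -> exists2 p, Gamma0 f p & C p = r) ->
  exists g, Pi f g.
Proof.
move=> C_mono C_onto.
have one01 : 0 <= (1 : R) <= 1 by rewrite ler01 lexx.
have G0 := Gamma0_start f; have G1 := Gamma0_value f one01.
have C_le p q : Gamma0 f p -> Gamma0 f q -> graph_le f p q -> C p <= C q.
  move=> Gp Gq /(graph_le_eqVlt Gp Gq)[->|/(C_mono _ _ Gp Gq)/ltW //].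
  exact: lexx.
have C_inj p q : Gamma0 f p -> Gamma0 f q -> C p = C q -> p = q.
  move=> Gp Gq E; case: (graph_le_total f p q) => [/(graph_le_eqVlt Gp Gq)[//|L]|L].
    by have := C_mono _ _ Gp Gq L; rewrite E ltxx.
  by have := C_mono _ _ Gq Gp L; rewrite E ltxx.
have ab : C (0, 0) < C (1, f 1) by apply: C_mono => //; left; exact: ltr01.
have Ca p : Gamma0 f p -> C (0, 0) <= C p.
  by move=> Gp; apply: C_le => //; exact: graph_le_start.
have Cb p : Gamma0 f p -> C p <= C (1, f 1).
  by move=> Gp; apply: C_le => //; exact: graph_le_end.
move: (C (0, 0)) (C (1, f 1)) C_onto ab Ca Cb => a b C_onto ab Ca Cb.
have Hr u : exists p, 0 <= u <= 1 -> Gamma0 f p /\ C p = a + u * (b - a).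
  have [/andP[u0 u1]|] := boolP (0 <= u <= 1); last by exists (0, 0).
  have /C_onto[p Gp Ep] : a <= a + u * (b - a) <= b.
    have : 0 <= u * (b - a) by rewrite mulr_ge0 // subr_ge0 ltW.
    have : u * (b - a) <= b - a by rewrite ler_piMl // subr_ge0 ltW.
    by move: (u * (b - a)) => x *; apply/andP; split; lra.
  by exists p.
have [g Hg] := choice Hr.
have Hg' r : 0 <= r -> r <= 1 -> Gamma0 f (g r) /\ C (g r) = a + r * (b - a).
  by move=> r0 r1; apply: Hg; rewrite r0.
have ba : b - a != 0 by rewrite subr_eq0 gt_eqF.
exists g; split.
- by move=> r r0 r1; case: (Hg' r r0 r1).
- move=> p Gp; pose r := (C p - a) / (b - a).
  have r0 : 0 <= r by rewrite divr_ge0 // subr_ge0 ?Ca // ltW.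
  have r1 : r <= 1 by rewrite ler_pdivrMr ?mul1r ?subr_gt0 // lerD2r Cb.
  exists r; split => //; have [Gg Eg] := Hg' r r0 r1.
  by apply: C_inj => //; rewrite Eg divfK // addrC subrK.
- move=> r r' r0 r1 r'0 r'1 E.
  have [_ E1] := Hg' r r0 r1; have [_ E2] := Hg' r' r'0 r'1.
  by move: E1; rewrite E E2 => /addrI /(mulIf ba).
- move=> r r' r0 rr r'1.
  have [G1' E1] := Hg' r r0 (le_trans rr r'1).
  have [G2' E2] := Hg' r' (le_trans r0 rr) r'1.
  have [h|/(C_mono _ _ G2' G1')] := graph_le_total f (g r) (g r'); first exact: h.
  by rewrite E1 E2 ltrD2l ltr_pM2r ?subr_gt0 // ltNge rr.
Qed.

Lemma Pi_nonempty : exists g, Pi f g.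
Proof.
apply: (Pi_of_clock (C := clock)) => [p q|r]; first exact: clock_mono.
exact: clock_onto.
Qed.

End JumpCodes.

(** * Matching two completed graphs *)

Section Matching.
Context {R : realType}.
Implicit Types (f g : R -> R) (e r s : R) (p y z : R * R) (u v : R -> R * R).

Lemma graph_le_neqlt f p y : Gamma0 f p -> Gamma0 f y -> graph_le f p y -> p <> y ->
  graph_lt f p y.
Proof. by move=> Gp Gy py N; case: (graph_le_eqVlt Gp Gy py). Qed.

Lemma graph_lt_of_Pi f u r r' : Pi f u -> 0 <= r -> r < r' -> r' <= 1 ->
  graph_lt f (u r) (u r').
Proof.
move=> [uG _ uinj umono] r0 rr r'1.
have r1 : r <= 1 by rewrite (le_trans (ltW rr)).
have r'0 : 0 <= r' by rewrite (le_trans r0) // ltW.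
apply: (graph_le_neqlt (uG _ r0 r1) (uG _ r'0 r'1) (umono _ _ r0 (ltW rr) r'1)) => E.
by have := uinj _ _ r0 r1 r'0 r'1 E => rE; rewrite rE ltxx in rr.
Qed.

Lemma Pi_lt_of_graph f u r r' : Pi f u -> 0 <= r -> r <= 1 -> 0 <= r' -> r' <= 1 ->
  graph_lt f (u r) (u r') -> r < r'.
Proof.
move=> [_ _ _ umono] r0 r1 r'0 r'1 L; rewrite ltNge; apply/negP => rr.
exact: graph_lt_irr (graph_lt_le_trans L (umono _ _ r'0 rr r1)).
Qed.

Lemma Pi_start f u r : Pi f u -> 0 <= r -> r <= 1 -> u r = (0, 0) -> r = 0.
Proof.
move=> Pu r0 r1 E; apply/eqP; rewrite eq_le r0 andbT leNgt; apply/negP => r0'.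
have := graph_lt_of_Pi Pu (lexx 0) r0' r1; rewrite E.
move=> /graph_lt_le_trans /(_ (graph_le_start _)) H.
by case: Pu => uG _ _ _; apply: graph_lt_irr (H _ (uG 0 (lexx _) ler01)).
Qed.

Lemma Pi_end f u r : Pi f u -> 0 <= r -> r <= 1 -> u r = (1, f 1) -> r = 1.
Proof.
move=> Pu r0 r1 E; apply/eqP; rewrite eq_le r1 /= leNgt; apply/negP => r1'.
have := graph_lt_of_Pi Pu r0 r1' (lexx 1); rewrite E.
case: Pu => uG _ _ _; have := graph_le_end (uG 1 ler01 (lexx _)).
by move=> H /(graph_le_lt_trans H); exact: graph_lt_irr.
Qed.

Definition close_pts e p z := `|p.1 - z.1| <= e /\ `|p.2 - z.2| <= e.

(** Corresponding arcs are close in the strong sense that any two of their points are, so that only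
    the ends of the arcs have to be synchronized. *)
Inductive matched f g e : R * R -> R * R -> Prop :=
| matched_start : matched f g e (0, 0) (0, 0)
| matched_step p p' z z' : matched f g e p p' -> Gamma0 f z -> Gamma0 g z' ->
    graph_lt f p z -> graph_lt g p' z' ->
    (forall y y', Gamma0 f y -> Gamma0 g y' -> graph_le f p y -> graph_le f y z ->
       graph_le g p' y' -> graph_le g y' z' -> close_pts e y y') ->
    matched f g e z z'.

Lemma matched_Gamma0 f g e p p' : matched f g e p p' -> Gamma0 f p /\ Gamma0 g p'.
Proof. by case=> //; split; exact: Gamma0_start. Qed.

(** Induction on the chain builds a time change. On the last arc it is the affine map of slope [sl]
    between the parameter intervals of the two arcs. *)
Lemma matched_glue f g e u v z z' : Pi f u -> Pi g v -> 0 <= e -> matched f g e z z' ->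
  forall rho sig, 0 <= rho -> rho <= 1 -> 0 <= sig -> sig <= 1 ->
  u rho = z -> v sig = z' ->
  exists tau : R -> R, [/\ forall r, 0 <= r <= rho -> 0 <= tau r <= sig,
    forall r r', 0 <= r -> r < r' -> r' <= rho -> tau r < tau r',
    forall s, 0 <= s <= sig -> exists2 r, 0 <= r <= rho & tau r = s &
    forall r, 0 <= r <= rho -> close_pts e (u r) (v (tau r))].
Proof.
move=> Pu Pv e0; elim=> [|z1 z1' w w' M IH Gw Gw' L L' C] rho sig rho0 rho1 sig0 sig1 ur vs.
  have ? := Pi_start Pu rho0 rho1 ur; have ? := Pi_start Pv sig0 sig1 vs; subst rho sig.
  exists id; split => //; first by move=> s s0; exists s.
  by move=> r; rewrite -eq_le => /eqP <-; rewrite ur vs; split; rewrite subrr normr0.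
have [uG uonto _ umono] := Pu; have [vG vonto _ vmono] := Pv.
have [Gz Gz'] := matched_Gamma0 M.
have [a [a0 a1 ua]] := uonto _ Gz; have [b [b0 b1 vb]] := vonto _ Gz'.
have ar : a < rho by apply: (Pi_lt_of_graph Pu a0 a1 rho0 rho1); rewrite ua ur.
have bs : b < sig by apply: (Pi_lt_of_graph Pv b0 b1 sig0 sig1); rewrite vb vs.
have [tau0 [T1 T2 T3 T4]] := IH a b a0 a1 b0 b1 ua vb.
pose sl := (sig - b) / (rho - a).
have sl0 : 0 < sl by rewrite divr_gt0 // subr_gt0.
pose tau r := if r <= a then tau0 r else b + (r - a) * sl.
have tau_lo r : 0 <= r <= a -> 0 <= tau r <= b.
  by move=> /andP[r0 ra]; rewrite /tau ra T1 // r0.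
have tau_hi r : a < r -> r <= rho -> b < tau r /\ tau r <= sig.
  move=> ra rr; rewrite /tau leNgt ra /= ltrDl mulr_gt0 ?subr_gt0 //; split => //.
  rewrite addrC -lerBrDr /sl mulrA ler_pdivrMr ?subr_gt0 // mulrC.
  by rewrite ler_pM2l ?subr_gt0 // lerD2r.
exists tau; split.
- move=> r /andP[r0 rr]; have [ra|ra] := leP r a.
    by have /andP[-> h] := tau_lo r ltac:(by rewrite r0); rewrite (le_trans h) // ltW.
  by have [h ->] := tau_hi r ra rr; rewrite (le_trans b0) // ltW.
- move=> r r' r0 rr r'r; have [r'a|r'a] := leP r' a.
    by rewrite /tau r'a (le_trans (ltW rr) r'a) T2.
  have [ra|ra] := leP r a.
    have /andP[_ h] := tau_lo r ltac:(by rewrite r0).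
    by have [h' _] := tau_hi r' r'a r'r; apply: le_lt_trans h'.
  by rewrite /tau !leNgt ra r'a /= ltrD2l ltr_pM2r // ltrD2r.
- move=> s /andP[s0 ss]; have [sb|sb] := leP s b.
    have [|r /andP[r0 ra] <-] := T3 s; first by rewrite s0.
    by exists r; rewrite /tau ?ra // r0 (le_trans ra) // ltW.
  have q0 : 0 < (s - b) / sl by rewrite divr_gt0 // subr_gt0.
  exists (a + (s - b) / sl); last first.
    by rewrite /tau leNgt ltrDl q0 /= [a + _]addrC addrK divfK ?gt_eqF // addrC subrK.
  rewrite addr_ge0 ?(ltW q0) //= addrC -lerBrDr ler_pdivrMr // /sl mulrC divfK ?lerD2r //.
  by rewrite gt_eqF // subr_gt0.
- move=> r /andP[r0 rr]; have [ra|ra] := leP r a.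
    by rewrite /tau ra; apply: T4; rewrite r0.
  have [h1 h2] := tau_hi r ra rr.
  have r1 := le_trans rr rho1; have t0 := le_trans b0 (ltW h1); have t1 := le_trans h2 sig1.
  apply: C; [exact: uG|exact: vG|..].
  + by rewrite -ua; apply: umono => //; exact: ltW.
  + by rewrite -ur; apply: umono.
  + by rewrite -vb; apply: vmono => //; exact: ltW.
  + by rewrite -vs; apply: vmono.
Qed.

Lemma dist_le_matched f g e : cadlag f -> cadlag g -> 0 <= e ->
  matched f g e (1, f 1) (1, g 1) -> (dist f g <= e%:E)%E.
Proof.
move=> cf cg e0 M.
have [u Pu] := Pi_nonempty cf; have [v Pv] := Pi_nonempty cg.
have [uG uonto _ umono] := Pu; have [vG vonto vinj vmono] := Pv.
have [G1 G1'] := matched_Gamma0 M.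
have [rho [rho0 rho1 ur]] := uonto _ G1; have [sig [sig0 sig1 vs]] := vonto _ G1'.
have ? := Pi_end Pu rho0 rho1 ur; have ? := Pi_end Pv sig0 sig1 vs; subst rho sig.
have [tau [T1 T2 T3 T4]] := matched_glue Pu Pv e0 M rho0 rho1 sig0 sig1 ur vs.
have T1' r : 0 <= r -> r <= 1 -> 0 <= tau r /\ tau r <= 1.
  by move=> r0 r1; apply/andP; apply: T1; rewrite r0.
apply: (@le_trans _ _ (ereal_sup [set (Num.max `|(u r).1 - (v (tau r)).1|
  `|(u r).2 - (v (tau r)).2|)%:E | r in `[0, 1]%classic])).
  apply: ereal_inf_lbound; exists u, (v \o tau); split; [exact: Pu| |by []]; split.
  - by move=> r r0 r1; have [? ?] := T1' r r0 r1; exact: vG.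
  - move=> p /vonto[s [s0 s1 <-]]; have [|r /andP[r0 r1] <-] := T3 s; first by rewrite s0.
    by exists r.
  - move=> r r' r0 r1 r'0 r'1 /=.
    have [a a'] := T1' r r0 r1; have [b b'] := T1' r' r'0 r'1.
    move=> /vinj -/(_ a a' b b') E; have [lt|lt|//] := ltgtP r r'.
      by have := T2 r r' r0 lt r'1; rewrite E ltxx.
    by have := T2 r' r r'0 lt r1; rewrite E ltxx.
  - move=> r r' r0; rewrite le_eqVlt => /orP[/eqP -> _|rr r'1 /=].
      exact: graph_le_refl.
    have r1 := le_trans (ltW rr) r'1; have r'0 := le_trans r0 (ltW rr).
    have [a a'] := T1' r r0 r1; have [b b'] := T1' r' r'0 r'1.
    by apply: vmono => //; apply: ltW; exact: T2.
apply: ge_ereal_sup => _ [r /= + <-]; rewrite in_itv /= => r01.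
by have [a b] := T4 r r01; rewrite lee_fin ge_max a b.
Qed.

Lemma btw_dist (eta c r a x b : R) : btw eta a x b -> `|a - c| <= r -> `|b - c| <= r ->
  `|x - c| <= eta + r.
Proof.
rewrite !ler_norml => /andP[/orP[?|?] /orP[?|?]] /andP[? ?] /andP[? ?];
  by apply/andP; split; lra.
Qed.

Lemma dist_chain (x y c c' r k e : R) : `|x - c| <= r -> `|c - c'| <= k -> `|y - c'| <= r ->
  r + k + r <= e -> `|x - y| <= e.
Proof.
by rewrite !ler_norml => /andP[? ?] /andP[? ?] /andP[? ?] ?; apply/andP; split; lra.
Qed.

Lemma dist_interval (a b x y e : R) : a <= x -> x <= b -> a <= y -> y <= b -> b - a <= e ->
  `|x - y| <= e.
Proof. by move=> *; rewrite ler_norml; apply/andP; split; lra. Qed.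

(** Cuts the arc at equally spaced heights: the intermediate value theorem splits off the first step
    and the induction divides the rest. Distinct heights at the ends force distinct cut points. *)
Lemma graph_levels_ne f z L p : cadlag f -> Gamma0 f p -> Gamma0 f z ->
  graph_lt f p z -> p.2 != z.2 -> exists y : nat -> R * R, [/\ y 0%N = p,
    y L.+1 = z, forall j, (j < L.+1)%N -> graph_lt f (y j) (y j.+1) &
    forall j, (j <= L.+1)%N -> [/\ Gamma0 f (y j), graph_le f p (y j), graph_le f (y j) z &
      (y j).2 = p.2 + j%:R / L.+1%:R * (z.2 - p.2)]].
Proof.
move=> cf + Gz; elim: L p => [|L IH] p Gp pz pzN.
  exists (fun j => if j is 0%N then p else z); split; [exact: erefl|exact: erefl|by case=> [_|j]; [exact: pz|rewrite ltnS ltn0]|].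
  case=> [|[|//]] _; split.
  - exact: Gp.
  - exact: graph_le_refl.
  - exact: graph_ltW.
  - by rewrite mul0r mul0r addr0.
  - exact: Gz.
  - exact: graph_ltW.
  - exact: graph_le_refl.
  - by rewrite divr1 mul1r addrC subrK.
have L0 : L.+2%:R != 0 :> R by rewrite pnatr_eq0.
have L1 : L.+1%:R != 0 :> R by rewrite pnatr_eq0.
have EL : L.+2%:R = L.+1%:R + 1 :> R by rewrite -natr1.
have Li0 : 0 < L.+2%:R^-1 :> R by rewrite invr_gt0 ltr0n.
have Li1 : L.+2%:R^-1 < 1 :> R by rewrite invf_lt1 ?ltr0n // ltr1n.
pose l := p.2 + L.+2%:R^-1 * (z.2 - p.2).
have [w [Gw pw wz wl]] : exists y, [/\ Gamma0 f y, graph_le f p y, graph_le f y z & y.2 = l].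
  apply: graph_IVT => //; first exact: graph_ltW.
  rewrite /l; case/orP: (le_total p.2 z.2) => h; [left|right].
    rewrite lerDl mulr_ge0 ?(ltW Li0) ?subr_ge0 //= addrC -lerBrDr.
    by rewrite ler_piMl ?subr_ge0 // ltW.
  rewrite gerDl mulr_ge0_le0 ?(ltW Li0) ?subr_le0 // andbT addrC -lerBlDr.
  by rewrite ler_niMl ?subr_le0 // ltW.
have pwlt : graph_lt f p w.
  apply: (graph_le_neqlt Gp Gw pw) => E.
  have /eqP : L.+2%:R^-1 * (z.2 - p.2) = 0 by apply: (addrI p.2); rewrite addr0 -/l -wl -E.
  by rewrite mulf_eq0 (gt_eqF Li0) subr_eq0 eq_sym (negPf pzN).
have wzN : w.2 != z.2.
  rewrite wl /l -subr_eq0.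
  rewrite (_ : _ - _ = (1 - L.+2%:R^-1) * (p.2 - z.2)); last by ring.
  by rewrite mulf_eq0 negb_or !subr_eq0 pzN andbT gt_eqF.
have wzlt : graph_lt f w z.
  by apply: (graph_le_neqlt Gw Gz wz) => E; rewrite E eqxx in wzN.
have [y [y0 yL ylt yH]] := IH w Gw wzlt wzN.
exists (fun j => if j is k.+1 then y k else p); split; [exact: erefl|exact: yL|..].
- by case=> [_|j]; [rewrite y0|exact: ylt].
- case=> [_|j jL].
    split; [exact: Gp|exact: graph_le_refl|exact: graph_ltW|by rewrite mul0r mul0r addr0].
  have [Gy wy yz yl] := yH j jL.
  split; [exact: Gy|exact: graph_le_trans wy|exact: yz|].
  rewrite yl wl /l -[j.+1%:R]natr1; field.
  by rewrite nat1r -natrD !pnatr_eq0.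
Qed.

Lemma graph_levels f dl eta p z L : cadlag f -> 0 <= eta -> modulus (ext f) dl eta ->
  Gamma0 f p -> Gamma0 f z -> graph_lt f p z -> z.1 - p.1 < dl ->
  exists y : nat -> R * R, [/\ y 0%N = p,
    y L.+1 = z, forall j, (j < L.+1)%N -> graph_lt f (y j) (y j.+1) &
    forall j, (j <= L.+1)%N -> [/\ Gamma0 f (y j), graph_le f p (y j), graph_le f (y j) z &
      `|(y j).2 - (p.2 + j%:R / L.+1%:R * (z.2 - p.2))| <= eta]].
Proof.
move=> cf eta0 mf Gp Gz pz span; have [E|N] := eqVneq p.2 z.2; last first.
  have [y [y0 yL ylt yH]] := graph_levels_ne L cf Gp Gz pz N.
  exists y; split; [exact: y0|exact: yL|exact: ylt|move=> j /yH[? ? ? ->]].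
  by split; [by []|by []|by []|rewrite subrr normr0].
(* The intermediate value theorem does not separate the points when [p.2 = z.2], but
   then the whole arc is flat up to [eta] and any increasing points will do. *)
have [u Pu] := Pi_nonempty cf; have [uG uonto _ umono] := Pu.
have [a [a0 a1 ua]] := uonto _ Gp; have [b [b0 b1 vb]] := uonto _ Gz.
have ab : a < b by apply: (Pi_lt_of_graph Pu a0 a1 b0 b1); rewrite ua vb.
pose r (j : nat) := a + j%:R / L.+1%:R * (b - a).
have r0 : r 0%N = a by rewrite /r mul0r mul0r addr0.
have rL : r L.+1 = b by rewrite /r divff ?pnatr_eq0 // mul1r addrC subrK.
have rlt i j : (i < j)%N -> r i < r j.
  by move=> ij; rewrite /r ltrD2l ltr_pM2r ?subr_gt0 // ltr_pM2r ?invr_gt0 ?ltr0n // ltr_nat.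
have rle i j : (i <= j)%N -> r i <= r j.
  by rewrite leq_eqVlt => /orP[/eqP -> //|/rlt /ltW].
have ra j : a <= r j by rewrite -r0 rle.
have rb j : (j <= L.+1)%N -> r j <= b by move=> jL; rewrite -rL rle.
exists (fun j => u (r j)); split; [by rewrite r0|by rewrite rL|..].
  move=> j jL; apply: (graph_lt_of_Pi Pu); [|exact: rlt|].
    exact: le_trans (ra _).
  exact: le_trans (rb _ jL) b1.
move=> j jL.
have G : Gamma0 f (u (r j)) by apply: uG; [exact: le_trans (ra _)|exact: le_trans (rb _ jL) b1].
have l1 : graph_le f p (u (r j)).
  by rewrite -ua; apply: umono => //; exact: le_trans (rb _ jL) b1.
have l2 : graph_le f (u (r j)) z.
  by rewrite -vb; apply: umono; rewrite ?rb //; exact: le_trans (ra _).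
split => //; have := graph_modulus cf eta0 mf Gp G Gz l1 l2 span.
rewrite -E subrr mulr0 addr0 ler_norml => /andP[].
by rewrite !orbb => *; apply/andP; split; lra.
Qed.

(** Both arcs are cut into [L.+1] pieces at proportional heights. On a piece the modulus keeps each
    graph near the heights of the cut points, which nearly agree for the two paths; in time both
    arcs stay in one interval of length at most [e]. *)
Lemma matched_segment f g dl eta kap e p p' z z' L :
  cadlag f -> cadlag g -> 0 <= eta -> modulus (ext f) dl eta -> modulus (ext g) dl eta ->
  matched f g e p p' -> Gamma0 f z -> Gamma0 g z' -> p.1 < z.1 ->
  p.1 = p'.1 -> z.1 = z'.1 -> z.1 - p.1 < dl -> z.1 - p.1 <= e ->
  `|p.2 - p'.2| <= kap -> `|z.2 - z'.2| <= kap ->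
  `|z.2 - p.2| / L.+1%:R <= kap -> `|z'.2 - p'.2| / L.+1%:R <= kap ->
  4 * eta + 3 * kap <= e -> matched f g e z z'.
Proof.
move=> cf cg eta0 mf mg M Gz Gz' pz E1 E2 dspan espan k1 k2 k3 k4 small.
have kap0 : 0 <= kap by apply: le_trans k1.
(* Cut points lie within [eta] of their nominal heights, consecutive nominal heights differ by at
   most [kap], and the modulus adds another [eta]. So each path is within [2 * eta + kap] of its
   nominal height, and the two nominal heights differ by at most [kap]. *)
have small' : (eta + (eta + kap)) + kap + (eta + (eta + kap)) <= e by lra.
have [Gp Gp'] := matched_Gamma0 M.
have pzlt : graph_lt f p z by left.
have pzlt' : graph_lt g p' z' by left; rewrite -E1 -E2.
have dspan' : z'.1 - p'.1 < dl by rewrite -E1 -E2.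
have [y [y0 yL ylt yH]] := graph_levels L cf eta0 mf Gp Gz pzlt dspan.
have [y' [y'0 y'L y'lt y'H]] := graph_levels L cg eta0 mg Gp' Gz' pzlt' dspan'.
rewrite -yL -y'L; have : (L.+1 <= L.+1)%N by [].
(* Only the index of the cut is generalized; its bound and the number of pieces stay fixed. *)
move: {1 3 4}L.+1 => j; elim: j => [|j IH] jL; first by rewrite y0 y'0.
have jL' := ltnW jL.
have [Gy py yz yl] := yH j jL'; have [Gy' py' yz' yl'] := y'H j jL'.
have [Gw pw wz wl] := yH j.+1 jL; have [Gw' pw' wz' wl'] := y'H j.+1 jL.
apply: (matched_step (IH jL') Gw Gw' (ylt _ jL) (y'lt _ jL)) => x x' Gx Gx' yx xw y'x x'w.
have le1 h (q q' : R * R) : graph_le h q q' -> q.1 <= q'.1.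
  by case=> [/ltW //|[-> _]].
have px := le1 _ _ _ (graph_le_trans py yx); have xz := le1 _ _ _ (graph_le_trans xw wz).
have px' := le1 _ _ _ (graph_le_trans py' y'x); have xz' := le1 _ _ _ (graph_le_trans x'w wz').
move: (le1 _ _ _ py) (le1 _ _ _ wz) (le1 _ _ _ py') (le1 _ _ _ wz') => q1 q2 q3 q4.
have B := graph_modulus cf eta0 mf Gy Gx Gw yx xw (le_lt_trans (lerB q2 q1) dspan).
have B' := graph_modulus cg eta0 mg Gy' Gx' Gw' y'x x'w (le_lt_trans (lerB q4 q3) dspan').
split.
  by apply: (dist_interval px xz _ _ espan); rewrite ?E1 ?E2.
have L0 : 0 < L.+1%:R :> R by rewrite ltr0n.
set a := z.2 - p.2 in k3 yl wl; set a' := z'.2 - p'.2 in k4 yl' wl'.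
have S (c : R) : j.+1%:R / L.+1%:R * c = j%:R / L.+1%:R * c + c / L.+1%:R.
  by rewrite -natr1; field; rewrite gt_eqF // addrC natr1.
rewrite S in wl; rewrite S in wl'.
have {}k3 : `|a / L.+1%:R| <= kap by rewrite normrM normfV (gtr0_norm L0).
have {}k4 : `|a' / L.+1%:R| <= kap by rewrite normrM normfV (gtr0_norm L0).
have kl : `|p.2 + j%:R / L.+1%:R * a - (p'.2 + j%:R / L.+1%:R * a')| <= kap.
  have : 0 <= j%:R / L.+1%:R :> R by rewrite divr_ge0.
  have : j%:R / L.+1%:R <= 1 :> R by rewrite ler_pdivrMr // mul1r ler_nat ltnW.
  move: (j%:R / L.+1%:R) => th th1 th0.
  rewrite (_ : _ - _ = (1 - th) * (p.2 - p'.2) + th * (z.2 - z'.2)); last first.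
    by rewrite /a /a'; ring.
  apply: le_trans (ler_normD _ _) _; rewrite !normrM (ger0_norm th0) ger0_norm ?subr_ge0 //.
  have h1 : (1 - th) * `|p.2 - p'.2| <= (1 - th) * kap by rewrite ler_wpM2l ?subr_ge0.
  have h2 : th * `|z.2 - z'.2| <= th * kap by rewrite ler_wpM2l.
  by rewrite (_ : kap = (1 - th) * kap + th * kap); [exact: lerD|ring].
set c := p.2 + _ in kl yl wl; set c' := p'.2 + _ in kl yl' wl'.
have wc : `|(y j.+1).2 - c| <= eta + kap.
  rewrite (_ : _ - c = ((y j.+1).2 - (c + a / L.+1%:R)) + a / L.+1%:R); last by ring.
  by apply: le_trans (ler_normD _ _) (lerD _ k3); rewrite /c -addrA.
have wc' : `|(y' j.+1).2 - c'| <= eta + kap.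
  rewrite (_ : _ - c' = ((y' j.+1).2 - (c' + a' / L.+1%:R)) + a' / L.+1%:R); last by ring.
  by apply: le_trans (ler_normD _ _) (lerD _ k4); rewrite /c' -addrA.
have yc : `|(y j).2 - c| <= eta + kap by apply: le_trans yl _; rewrite lerDl.
have yc' : `|(y' j).2 - c'| <= eta + kap by apply: le_trans yl' _; rewrite lerDl.
exact: (dist_chain (btw_dist B yc wc) kl (btw_dist B' yc' wc') small').
Qed.

End Matching.

(** * Compactness *)

Section ModulusLimits.
Context {R : realType}.
Implicit Types (a f : R -> R) (t e d B : R) (dl eta : nat -> R).

Definition moduli dl eta a B := (forall t, `|a t| <= B) /\
  forall n, modulus a (dl n) (eta n).

Variables (dl eta : nat -> R) (B : R).
Hypothesis dl0 : forall n, 0 < dl n.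
Hypothesis eta_small : forall e, 0 < e -> exists n, eta n <= e.

(** Compactness of [[- B, B]] gives a cluster value [l] from the right. Any [s] close to [t] lies
    between two times whose values are near [l], and the modulus with a small [eta n] traps its
    value. *)
Lemma moduli_right a t : moduli dl eta a B -> exists l, forall e, 0 < e ->
  exists2 d, 0 < d & forall s, t < s -> s < t + d -> `|a s - l| < e.
Proof.
move=> [aB am].
have FB : (a x @[x --> t^'+]) `[- B, B]%classic.
  by apply: nearW => s; rewrite /= in_itv /= -ler_norml.
have [l [_ Hl]] := @segment_compact R (- B) B _ _ FB.
exists l => e e0.
have near_l d : 0 < d -> exists s, [/\ t < s, s < t + d & `|a s - l| < e / 3].
  move=> d0; pose U := [set a s | s in [set s | t < s /\ s < t + d]].
  have FU : (a x @[x --> t^'+]) U.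
    change (\forall x \near t^'+, U (a x)); near=> s.
    exists s => //; split; near: s; first exact: nbhs_right_gt.
    by apply: nbhs_right_lt; rewrite ltrDl.
  have e3 : 0 < e / 3 by lra.
  have [_ [[s [ts std] <-]]] := Hl _ _ FU (nbhsx_ballx l _ e3).
  by rewrite /ball /= distrC => ?; exists s.
have [n Hn] := eta_small (e := e / 3) ltac:(lra).
have [s1 [ts1 s1d s1E]] := near_l _ (dl0 n).
exists (s1 - t) => [|s ts ss1]; first by lra.
have [s3 [ts3 s3s s3E]] := near_l (s - t) ltac:(lra).
have := am n s3 s s1 ltac:(lra) ltac:(lra) ltac:(lra).
move: s1E s3E; rewrite !ltr_norml => /andP[? ?] /andP[? ?].
by move=> /andP[/orP[?|?] /orP[?|?]]; apply/andP; split; lra.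
Unshelve. all: by end_near. Qed.

(** Time reversal of the previous lemma, as [btw] is symmetric in its outer points. *)
Lemma moduli_left a t : moduli dl eta a B -> exists l, forall e, 0 < e ->
  exists2 d, 0 < d & forall s, t - d < s -> s < t -> `|a s - l| < e.
Proof.
move=> [aB am].
have [|l Hl] := @moduli_right (fun s => a (- s)) (- t).
  split=> [s|n s1 s2 s3 s12 s23 s13]; first exact: aB.
  have := am n (- s3) (- s2) (- s1) ltac:(lra) ltac:(lra) ltac:(lra).
  by rewrite /btw [X in X && _ -> _]orbC [X in _ && X -> _]orbC.
exists l => e /Hl[d d0 Hd]; exists d => // s s1 s2.
by have := Hd (- s); rewrite opprK; apply; lra.
Qed.

Lemma right_regularization a : moduli dl eta a B -> exists f, forall t e, 0 < e ->
  exists2 d, 0 < d & forall s, t < s -> s < t + d -> `|a s - f t| < e.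
Proof.
move=> ma; have [f Hf] := choice (fun t => moduli_right t ma).
by exists f => t; exact: Hf.
Qed.

Lemma right_point t d d' : 0 < d -> 0 < d' -> exists s, [/\ t < s, s < t + d & s < t + d'].
Proof.
move=> d0 d'0; exists (t + Num.min d d' / 2).
have : Num.min d d' <= d by rewrite ge_min lexx.
have : Num.min d d' <= d' by rewrite ge_min lexx orbT.
have : 0 < Num.min d d' by rewrite lt_min d0.
by split; lra.
Qed.

Section Regularization.
Variables (a f : R -> R).
Hypothesis ma : moduli dl eta a B.
Hypothesis fE : forall t e, 0 < e ->
  exists2 d, 0 < d & forall s, t < s -> s < t + d -> `|a s - f t| < e.

Lemma regularization_approx t e d : 0 < e -> 0 < d ->
  exists s, [/\ t < s, s < t + d & `|a s - f t| < e].
Proof.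
move=> e0 d0; have [d' d'0 H] := fE t e0.
have [s [ts sd sd']] := right_point t d0 d'0.
by exists s; split => //; exact: H.
Qed.

Lemma regularization_right t e : 0 < e ->
  exists2 d, 0 < d & forall s, t < s -> s < t + d -> `|f s - f t| < e.
Proof.
move=> e0; have e2 : 0 < e / 2 by lra.
have [d d0 H] := fE t e2; exists d => // s ts sd.
have [u [su ud uE]] := regularization_approx s (d := t + d - s) e2 ltac:(lra).
have := H u ltac:(lra) ltac:(lra).
by move: uE; rewrite !ltr_norml => /andP[? ?] /andP[? ?]; apply/andP; split; lra.
Qed.

Lemma regularization_eq t c : (exists2 d, 0 < d & forall s, t < s -> s < t + d -> a s = c) ->
  f t = c.
Proof.
move=> [d d0 H]; apply/eqP; rewrite -subr_eq0 -normr_le0; apply/ler_addgt0Pr => e e0.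
have [s [ts sd sE]] := regularization_approx t e0 d0.
by rewrite add0r distrC -(H s ts sd) ltW.
Qed.

Lemma regularization_moduli : moduli dl eta f B.
Proof.
have [aB am] := ma; split=> [t|n s1 s2 s3 s12 s23 s13].
  apply/ler_addgt0Pr => e e0; have [s [_ _ sE]] := regularization_approx t e0 e0.
  have := aB s; move: sE; rewrite ler_norml ltr_norml ler_norml => /andP[? ?] /andP[? ?].
  by apply/andP; split; lra.
apply: btw_closed => e e0; have e2 : 0 < e / 2 by lra.
have [u1 [u1l u1r u1E]] := regularization_approx s1 (d := s2 - s1) e2 ltac:(lra).
have [u2 [u2l u2r u2E]] := regularization_approx s2 (d := s3 - s2) e2 ltac:(lra).
have [u3 [u3l u3r u3E]] := regularization_approx s3 (d := dl n - (s3 - s1)) e2 ltac:(lra).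
by apply: (btw_near u1E u2E u3E); apply: am; lra.
Qed.

Hypothesis a0 : forall t, t < 0 -> a t = 0.
Hypothesis a1 : forall t, 1 <= t -> a t = a 1.

Lemma regularization_lt0 t : t < 0 -> f t = 0.
Proof.
move=> t0; apply: regularization_eq; exists (- t) => [|s ts st]; first by lra.
by apply: a0; lra.
Qed.

Lemma regularization_ge1 t : 1 <= t -> f t = a 1.
Proof.
by move=> t1; apply: regularization_eq; exists 1 => // s ts st; apply: a1; lra.
Qed.

Lemma regularization_cadlag : cadlag f.
Proof.
split=> t t0 t1.
  by apply/cvg_right_epsP => e e0; have [d d0 H] := regularization_right t e0; exists d.
have [l Hl] := moduli_left t regularization_moduli.
by apply/cvg_ex; exists l; apply/cvg_left_epsP.
Qed.

Lemma regularization_ext : ext f = f.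
Proof.
apply/funext => t; rewrite /ext; case: ifPn => [/regularization_lt0 //|t0].
case: ifPn => // t1; rewrite !regularization_ge1 //; lra.
Qed.

(** The value of [a] at [t] need not be a one-sided limit, but the modulus squeezes it between
    values just before and just after [t]. These tend to the ends of the segment, and the error
    [eta n] can be made small. *)
Lemma regularization_between t : 0 < t -> t <= 1 -> Gamma0 f (t, a t).
Proof.
move=> t0 t1; have t01 : 0 <= t <= 1 by rewrite ltW.
suff : btw 0 (leftlim f t) (a t) (f t).
  rewrite /btw !addr0 !subr0 => /andP[/orP[H|H] /orP[H'|H']];
    apply: Gamma0I => //; first [by left; rewrite H H' | by right; rewrite H H' |
      by have [L|/ltW L] := leP (leftlim f t) (f t);
         [left|right]; apply/andP; split; lra].
apply: btw_closed => e e0; rewrite add0r.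
have e4 : 0 < e / 2 / 2 by lra.
have e2 : 0 < e / 2 by lra.
have [n Hn] := eta_small e2.
have [d d0 Hd] := ext_left regularization_cadlag t01 e4.
pose m := Num.min d (dl n / 2).
have m1 : m <= d by rewrite ge_min lexx.
have m2 : m <= dl n / 2 by rewrite ge_min lexx orbT.
have m0 : 0 < m by rewrite lt_min d0 /= divr_gt0.
have := Hd (t - m / 2) ltac:(lra) ltac:(lra); rewrite regularization_ext => sE.
(* Since [a] approaches [f] from the right, the earlier time is taken just after [t - m / 2] and
   still before [t]. *)
have [s [s1 s2 s3]] := regularization_approx (t - m / 2) (d := m / 2) e4 ltac:(lra).
have dl2 : 0 < dl n / 2 by rewrite divr_gt0.
have [u [u1 u2 u3]] := regularization_approx t e4 dl2.
have [_ am] := ma.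
have := am n s t u ltac:(lra) ltac:(lra) ltac:(lra).
move: sE s3 u3; rewrite !ltr_norml => /andP[? ?] /andP[? ?] /andP[? ?].
move=> /andP[/orP[?|?] /orP[?|?]]; apply/andP; split; apply/orP;
  solve [left; lra | right; lra].
Qed.

End Regularization.

End ModulusLimits.

Section Compactness.
Context {R : realType}.
Implicit Types (a f g h : R -> R) (t e d : R).

(** Tychonoff's theorem on the product of copies of [[- B, B]] indexed by all real times.
    Constraints on the finitely many coordinates in [s] define a neighbourhood in the product
    topology. *)
Lemma pointwise_cluster (F : set_system (R -> R)) (B : R) : ProperFilter F ->
  F [set h | forall t, `|h t| <= B] -> exists a, forall A (s : seq R) e, F A -> 0 < e ->
  exists2 h, A h & forall t, t \in s -> `|h t - a t| < e.
Proof.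
move=> FF FB.
have := @tychonoff R (fun=> R : topologicalType) (fun=> `[- B, B]%classic)
  (fun=> @segment_compact R (- B) B).
move=> /(_ F FF) [|a [_ Ha]].
  by apply: filterS FB => h hB t; rewrite /= in_itv /= -ler_norml.
exists a => A s e FA e0.
pose PT := prod_topology (fun _ : R => R : topologicalType).
have FN : Filter (@nbhs PT PT a) := @nbhs_filter PT a.
have : @nbhs PT PT a [set h | forall t, t \in s -> `|h t - a t| < e].
  elim: s => [|t s IH].
    apply: (@filterS _ _ FN setT); last exact: (@filterT _ _ FN).
    by move=> h _ t.
  have Ht := @proj_continuous R (fun=> R : topologicalType) t a _ (nbhsx_ballx (a t) _ e0).
  apply: (@filterS _ _ FN _ _ _ (@filterI _ _ FN _ _ Ht IH)) => h [h1 h2] u.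
  rewrite inE => /orP[/eqP ->|us]; last exact: h2.
  by rewrite distrC; exact: h1.
by move=> /(Ha _ _ FA)[h [? ?]]; exists h.
Qed.

Variables (dl eta : nat -> R) (B : R).
Hypothesis dl0 : forall n, 0 < dl n.
Hypothesis eta0 : forall n, 0 <= eta n.
Hypothesis eta_small : forall e, 0 < e -> exists n, eta n <= e.
Hypothesis B0 : 0 <= B.

Definition wM_ball : set (R -> R) := [set f | [/\ cadlag f,
  forall t, 0 <= t <= 1 -> `|f t| <= B & forall n, (wM f (dl n) <= (eta n)%:E)%E]].

Lemma wM_ball_moduli g : wM_ball g -> moduli dl eta (ext g) B.
Proof.
case=> cg gB gw; split=> [t|n]; last exact: modulus_ext.
rewrite /ext; case: ifPn => [_|t0]; first by rewrite normr0.
by case: ifPn => t1; apply: gB; lra.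
Qed.

Lemma moduli_wM_ball f : cadlag f -> moduli dl eta (ext f) B -> wM_ball f.
Proof.
move=> cf [fB fm]; split=> // [t t01|n]; first by rewrite -(ext01 f t01); exact: fB.
apply: ge_ereal_sup => _ [t1 [t [t2 [/andP[t10 t1t] /andP[tt2 t21] td ->]]]].
have [h1 h2 h3] : [/\ 0 <= t1 <= 1, 0 <= t <= 1 & 0 <= t2 <= 1] by split; lra.
rewrite lee_fin Mdist_le eta0 /=.
have := @side_modulus _ f (dl n) (eta n) t1 false t true t2 true cf (eta0 n) (fm n) h1 h2 h3.
rewrite /side !ext01 //; apply; [by left|by left|].
by rewrite ger0_norm in td; lra.
Qed.

Section Convergence.
Variables (a f : R -> R).
Hypothesis ma : moduli dl eta a B.
Hypothesis fE : forall t e, 0 < e ->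
  exists2 d, 0 < d & forall s, t < s -> s < t + d -> `|a s - f t| < e.
Hypothesis a_lt0 : forall t, t < 0 -> a t = 0.
Hypothesis a_ge1 : forall t, 1 <= t -> a t = a 1.

Let cf : cadlag f := regularization_cadlag dl0 eta_small ma fE.

(** At positive grid times the graph of [f] passes through the heights of [a], and that of [g]
    through its own nearby values. Chaining [matched_segment] over the cells bounds the distance. *)
Lemma dist_regularization e : 0 < e -> exists (m : nat) (kap : R), 0 < kap /\
  forall g, wM_ball g ->
    (forall i, (i <= m)%N -> `|g (i%:R / m%:R) - a (i%:R / m%:R)| <= kap) ->
    (dist f g <= e%:E)%E.
Proof.
(* Seven parts, since [matched_segment] asks for [4 * eta + 3 * kap <= e]. *)
move=> e0; have [n Hn] := @eta_small (e / 7) ltac:(lra).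
have [m [m0 mdl me]] : exists m : nat, [/\ (0 < m)%N, m%:R^-1 < dl n & m%:R^-1 < e :> R].
  have c0 : 0 < Num.min (dl n) e by rewrite lt_min dl0.
  exists (Num.bound (Num.min (dl n) e)^-1).
  have := archi_boundP (ltW (ltr0n R 1)); move: (archi_boundP (x := (Num.min (dl n) e)^-1)).
  rewrite invr_ge0 (ltW c0) => /(_ isT) H _.
  have bp : 0 < (Num.bound (Num.min (dl n) e)^-1)%:R :> R.
    by apply: lt_trans H; rewrite invr_gt0.
  split; first by rewrite -(ltr_nat R).
    apply: lt_le_trans (_ : Num.min (dl n) e <= _); last by rewrite ge_min lexx.
    by rewrite -[ltRHS]invrK ltf_pV2 // posrE invr_gt0.
  apply: lt_le_trans (_ : Num.min (dl n) e <= _); last by rewrite ge_min lexx orbT.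
  by rewrite -[ltRHS]invrK ltf_pV2 // posrE invr_gt0.
(* Heights bounded by [B] differ by at most [2 * B], so [L.+1] equal steps are at most [e / 7]
   each. *)
have [L HL] : exists L : nat, 2 * B / L.+1%:R <= e / 7.
  exists (Num.bound (2 * B / (e / 7))).
  have H := archi_boundP (x := 2 * B / (e / 7)) ltac:(by rewrite divr_ge0 ?mulr_ge0 //; lra).
  rewrite ler_pdivrMr ?ltr0n // [leRHS]mulrC -ler_pdivrMr; last lra.
  by apply: le_trans (ltW H) _; rewrite ler_nat.
exists m, (e / 7); split => [|g Kg gnear]; first by lra.
have mg := wM_ball_moduli Kg; have [cg gB _] := Kg.
have mR : 0 < m%:R :> R by rewrite ltr0n.
have fext := regularization_ext fE a_lt0 a_ge1.
have mf : moduli dl eta (ext f) B by rewrite fext; exact: regularization_moduli ma fE.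
(* Both chains begin at [(0, 0)], the first point of every completed graph, instead of at the
   heights [a 0] and [g 0]. *)
pose A i := if i is 0%N then 0 else a (i%:R / m%:R).
pose G i := if i is 0%N then 0 else g (i%:R / m%:R).
have tim i : (i <= m)%N -> 0 <= (i%:R / m%:R : R) <= 1.
  by move=> im; rewrite divr_ge0 //= ler_pdivrMr // mul1r ler_nat.
have AB i : `|A i| <= B by case: i => [|i]; rewrite /A ?normr0 //; case: ma.
have GB i : (i <= m)%N -> `|G i| <= B.
  by case: i => [|i] im; rewrite /G ?normr0 //; apply/gB/tim.
have AG i : (i <= m)%N -> `|A i - G i| <= e / 7.
  by case: i => [|i] im; rewrite /A /G ?subrr ?normr0; [lra|rewrite distrC gnear].
have GA i : (i <= m)%N -> Gamma0 f (i%:R / m%:R, A i).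
  case: i => [|i] im; first by rewrite mul0r; exact: Gamma0_start.
  have /andP[_ t1] := tim _ im.
  apply: (regularization_between dl0 eta_small ma fE a_lt0 a_ge1) => //.
  by rewrite divr_gt0 // ltr0n.
have GG i : (i <= m)%N -> Gamma0 g (i%:R / m%:R, G i).
  case: i => [|i] im; first by rewrite mul0r; exact: Gamma0_start.
  exact/Gamma0_value/tim.
have lev (F : nat -> R) i : `|F i.+1| <= B -> `|F i| <= B ->
    `|F i.+1 - F i| / L.+1%:R <= e / 7.
  move=> h1 h2; apply: le_trans HL; rewrite ler_pM2r ?invr_gt0 ?ltr0n //.
  by apply: le_trans (ler_normB _ _) _; lra.
have step i : i.+1%:R / m%:R - i%:R / m%:R = m%:R^-1 :> R.
  by rewrite -mulrBl -natr1 addrC addKr mul1r.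
have M i : (i <= m)%N -> matched f g e (i%:R / m%:R, A i) (i%:R / m%:R, G i).
  elim: i => [|i IH] im; first by rewrite mul0r; exact: matched_start.
  have im' := ltnW im.
  apply: (matched_segment (p := (i%:R / m%:R, A i)) (p' := (i%:R / m%:R, G i))
    (dl := dl n) (eta := eta n) (kap := e / 7) (L := L) cf cg (eta0 n) (mf.2 n) (mg.2 n)) => /=.
  - exact: IH.
  - exact: GA.
  - exact: GG.
  - by rewrite ltr_pM2r ?invr_gt0 // ltr_nat.
  - by [].
  - by [].
  - by rewrite step.
  - by rewrite step ltW.
  - exact: AG im'.
  - exact: (AG i.+1 im).
  - exact: (lev A i (AB _) (AB _)).
  - exact: (lev G i (GB _ im) (GB _ im')).
  - by lra.
apply: dist_le_matched => //; first exact: ltW.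
have := M m (leqnn m); rewrite divff ?gt_eqF //.
have Am k : (0 < k)%N -> k = m -> A k = f 1 /\ G k = g 1.
  by case: k => // k _ E; rewrite /A /G E divff ?gt_eqF // (regularization_ge1 fE).
by have [-> ->] := Am m m0 erefl.
Qed.

End Convergence.

Lemma wM_ball_compact : Dcompact wM_ball.
Proof.
split=> [f [] //|C Copen KC].
apply: contrapT => nofin.
(* The paths left uncovered by finite subfamilies form a filter base, proper because there is no
   finite subcover. *)
pose rest (F : set (set (R -> R))) := ext @` (wM_ball `\` \bigcup_(U in F) U).
pose FF := filter_from [set F : set (set (R -> R)) | finite_set F /\ F `<=` C] rest.
have FFproper : ProperFilter FF.
  apply: filter_from_proper; last first.
    move=> F [finF FC]; apply: contrapT => N; apply: nofin; exists F => //.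
    move=> f Kf; apply: contrapT => Nf; apply: N; exists (ext f); exists f => //.
  apply: filter_from_filter; first by exists set0; split.
  move=> F1 F2 [fin1 F1C] [fin2 F2C]; exists (F1 `|` F2).
    by split; [rewrite finite_setU|move=> U [/F1C|/F2C]].
  move=> _ [f [Kf Nf] <-]; split; exists f => //; split => // -[U FU Uf];
    apply: Nf; exists U => //; [by left|by right].
have FB : FF [set h | forall t, `|h t| <= B].
  exists set0; first by split.
  by move=> _ [f [Kf _] <-] t; case: (wM_ball_moduli Kf).
have [a Ha] := pointwise_cluster FFproper FB.
have FK : FF (ext @` wM_ball).
  exists set0; first by split.
  by move=> _ [f [Kf _] <-]; exists f.
have approx (s : seq R) e : 0 < e -> exists2 g, wM_ball g &
    forall t, t \in s -> `|ext g t - a t| < e.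
  by move=> e0; have [_ [g Kg <-] H] := Ha _ s e FK e0; exists g.
have limit_eq (x y : R) : (forall e, 0 < e -> `|x - y| < e) -> x = y.
  move=> H; apply/eqP; rewrite -subr_eq0 -normr_le0; apply/ler_addgt0Pr => e e0.
  by rewrite add0r ltW // H.
have ma : moduli dl eta a B.
  split=> [t|n s1 s2 s3 s12 s23 s13].
    apply/ler_addgt0Pr => e e0; have [g Kg /(_ t)] := approx [:: t] e e0.
    rewrite inE eqxx => /(_ isT); have := (wM_ball_moduli Kg).1 t.
    rewrite ler_norml ltr_norml ler_norml => /andP[? ?] /andP[? ?].
    by apply/andP; split; lra.
  apply: btw_closed => e e0; have e2 : 0 < e / 2 by lra.
  have [g Kg H] := approx [:: s1; s2; s3] _ e2.
  have := (wM_ball_moduli Kg).2 n _ _ _ s12 s23 s13.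
  by apply: btw_near; apply: H; rewrite !inE eqxx ?orbT.
have a_lt0 t : t < 0 -> a t = 0.
  move=> t0; apply: limit_eq => e e0; have [g Kg /(_ t)] := approx [:: t] e e0.
  by rewrite inE eqxx ext_lt0 // distrC => /(_ isT).
have a_ge1 t : 1 <= t -> a t = a 1.
  move=> t1; apply: limit_eq => e e0; have e2 : 0 < e / 2 by lra.
  have [g Kg H] := approx [:: t; 1] _ e2.
  have := H t; rewrite inE eqxx => /(_ isT).
  have := H 1; rewrite !inE eqxx orbT => /(_ isT).
  rewrite !ext_ge1 // !ltr_norml => /andP[? ?] /andP[? ?].
  by apply/andP; split; lra.
have [f fE] := right_regularization dl0 eta_small ma.
have cf := regularization_cadlag dl0 eta_small ma fE.
have Kf : wM_ball f.
  apply: moduli_wM_ball => //; rewrite (regularization_ext fE a_lt0 a_ge1).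
  exact: regularization_moduli ma fE.
have [U CU Uf] := KC f Kf.
have [_ /(_ f Uf)[r r0 Hr]] := Copen _ CU.
have r2 : 0 < r / 2 by lra.
have [m [kap [kap0 near_f]]] := dist_regularization ma fE a_lt0 a_ge1 r2.
(* The filter contains the set of paths outside [U]. Such a path close to [a] on the grid is
   [dist]-close to [f], hence in [U]: a contradiction. *)
have FU : FF (rest [set U]).
  by exists [set U] => //; split; [exact: finite_set1|move=> _ ->].
have [_ [g [Kg Ug] <-] Hg] := Ha _ [seq i%:R / m%:R | i <- iota 0 m.+1] kap FU kap0.
apply: Ug; exists U => //; apply: Hr; first by case: Kg.
apply: le_lt_trans (_ : (r / 2)%:E < _)%E; last by rewrite lte_fin; lra.
apply: near_f => // i im.
have tim : 0 <= (i%:R / m%:R : R) <= 1.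
  rewrite divr_ge0 //=; case: (posnP m) => [->|m0]; first by rewrite invr0 mulr0.
  by rewrite ler_pdivrMr ?ltr0n // mul1r ler_nat.
rewrite -(ext01 g tim) ltW // Hg //; apply/mapP; exists i => //.
by rewrite mem_iota add0n ltnS.
Qed.

End Compactness.

(** * Chaining on dyadic grids *)

Lemma btw_mono {R : realType} (e e' x y z : R) : e <= e' -> btw e x y z -> btw e' x y z.
Proof.
by move=> ee /andP[/orP[?|?] /orP[?|?]]; apply/andP; split; apply/orP;
  solve [left; lra | right; lra].
Qed.

Section DyadicChaining.
Context {R : realType}.
Implicit Types (f : R -> R) (th : nat -> R) (t e d : R).

Definition dyad m k : R := k%:R / 2 ^+ m.

Lemma dyad_double m k : dyad m.+1 k.*2 = dyad m k.
Proof.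
have p0 : 2 ^+ m != 0 :> R by rewrite expf_neq0.
by rewrite /dyad exprS -muln2 natrM; field.
Qed.

Definition adjacent_btw f th n := forall m k, (n <= m)%N -> (k.+2 <= 2 ^ m)%N ->
  btw (th m) (f (dyad m k)) (f (dyad m k.+1)) (f (dyad m k.+2)).

Lemma adjacent_btwN f th n : adjacent_btw f th n -> adjacent_btw (\- f) th n.
Proof. by move=> H m k nm km; rewrite /= btwN; exact: H. Qed.

(** An even index is already on the coarser grid. An odd one is the middle of an adjacent triple
    with both outer points on the coarser grid, one of which is high enough up to [th m.+1]. *)
Lemma dyad_coarsen_le f th n m x : 0 <= th m.+1 -> adjacent_btw f th n -> (n <= m)%N ->
  (x <= 2 ^ m.+1)%N -> exists y, [/\ (y <= 2 ^ m)%N, (x <= y.*2 + odd x)%N,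
    (y.*2 <= x + odd x)%N & f (dyad m.+1 x) <= f (dyad m y) + th m.+1].
Proof.
move=> th0 H nm xm; have E := odd_double_half x; rewrite expnS in xm.
case: (boolP (odd x)) => ox; last first.
  exists x./2; rewrite (negPf ox) add0n in E; split; [lia..|].
  by rewrite -(dyad_double m) E lerDl.
rewrite ox add1n in E *; have := H m.+1 (x./2).*2 (leqW nm).
rewrite expnS => /(_ ltac:(lia)) /andP[+ _].
have E2 : x.+1 = (x./2.+1).*2 by lia.
rewrite E E2 !dyad_double.
by move=> /orP[?|?]; [exists x./2|exists x./2.+1]; split => //; lia.
Qed.

Lemma dyad_coarsen_ge f th n m x : 0 <= th m.+1 -> adjacent_btw f th n -> (n <= m)%N ->
  (x <= 2 ^ m.+1)%N -> exists y, [/\ (y <= 2 ^ m)%N, (x <= y.*2 + odd x)%N,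
    (y.*2 <= x + odd x)%N & f (dyad m y) - th m.+1 <= f (dyad m.+1 x)].
Proof.
move=> th0 /adjacent_btwN H nm xm.
by have [y [? ? ? /= ?]] := dyad_coarsen_le th0 H nm xm; exists y; split => //; lra.
Qed.

(** The factor [2] accounts for two replacements at each finer level, one of the middle point and
    one of an outer point. *)
Definition chain_bound th n j : R := th n + \sum_(i < j) 2 * th (n + i.+1)%N.

(* Passing to the coarser grid moves each of the three points to a neighbour;
   a span of [2 ^ j.+1 + 1] cells shrinks to at most [2 ^ j + 1] cells, so that at
   level [n] only adjacent triples remain. *)
Lemma dyad_chain_le f th n j i k l : (forall m, 0 <= th m) -> adjacent_btw f th n ->
  (i <= k)%N -> (k <= l)%N -> (l <= 2 ^ (n + j))%N -> (l - i <= (2 ^ j).+1)%N ->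
  let u x := f (dyad (n + j) x) in
  (u k <= u i + chain_bound th n j) || (u k <= u l + chain_bound th n j).
Proof.
move=> th0 H; elim: j i k l => [|j IH] i k l ik kl ln span /=.
  rewrite addn0 in ln *; rewrite /chain_bound big_ord0 addr0.
  have [->|iNk] := eqVneq i k; first by rewrite lerDl th0.
  have [->|kNl] := eqVneq k l; first by rewrite lerDl th0 orbT.
  have -> : k = i.+1 by rewrite expn0 in span; lia.
  have lE : l = i.+2 by rewrite expn0 in span; lia.
  by rewrite lE; have /andP[] := H n i (leqnn n) ltac:(lia).
have b0 : 0 <= chain_bound th n j.+1.
  by rewrite addr_ge0 // sumr_ge0 // => x _; rewrite mulr_ge0.
have [->|iNk] := eqVneq i k; first by rewrite lerDl b0.
have [->|kNl] := eqVneq k l; first by rewrite lerDl b0 orbT.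
rewrite addnS in ln *; have nm : (n <= n + j)%N by lia.
have t0 := th0 (n + j).+1.
have [y1 [a1 b1 c1 d1]] := dyad_coarsen_ge t0 H nm (x := i) ltac:(lia).
have [y2 [a2 b2 c2 d2]] := dyad_coarsen_le t0 H nm (x := k) ltac:(lia).
have [y3 [a3 b3 c3 d3]] := dyad_coarsen_ge t0 H nm ln.
have Ei := odd_double_half i; have Ek := odd_double_half k; have El := odd_double_half l.
have [y12 y23 y13] : [/\ (y1 <= y2)%N, (y2 <= y3)%N & (y3 - y1 <= (2 ^ j).+1)%N].
  have [] : [/\ (odd i <= 1)%N, (odd k <= 1)%N & (odd l <= 1)%N] by rewrite !leq_b1.
  rewrite expnS in span; move: (2 ^ j)%N span => p span.
  by move: (odd i : nat) (odd k : nat) (odd l : nat) b1 c1 b2 c2 b3 c3 Ei Ek El => *; split; lia.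
have := IH y1 y2 y3 y12 y23 a3 y13 => /=.
have -> : chain_bound th n j.+1 = chain_bound th n j + 2 * th (n + j).+1.
  by rewrite /chain_bound big_ord_recr /= addrA addnS.
by move=> /orP[?|?]; apply/orP; [left|right]; lra.
Qed.

Lemma dyad_chain f th n j i k l : (forall m, 0 <= th m) -> adjacent_btw f th n ->
  (i <= k)%N -> (k <= l)%N -> (l <= 2 ^ (n + j))%N -> (l - i <= (2 ^ j).+1)%N ->
  btw (chain_bound th n j) (f (dyad (n + j) i)) (f (dyad (n + j) k)) (f (dyad (n + j) l)).
Proof.
move=> th0 H ik kl ln span; apply/andP; split; first exact: dyad_chain_le.
have /= := dyad_chain_le th0 (adjacent_btwN H) ik kl ln span.
by move=> /orP[?|?]; apply/orP; [left|right]; lra.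
Qed.

Lemma nat_below (x : R) : 0 < x -> exists k : nat, k%:R < x <= k.+1%:R.
Proof.
move=> x0; have /andP[a b] := truncn_itv (ltW x0).
have [E|N] := eqVneq (truncn x)%:R x; last first.
  by exists (truncn x); rewrite lt_neqAle N a ltW.
exists (truncn x).-1; have t0 : (0 < truncn x)%N by rewrite -(ltr0n R) E.
by rewrite prednK // E lexx andbT -[ltRHS]E ltr_nat prednK.
Qed.

Lemma nat_above (x : R) : 0 <= x -> exists k : nat, x < k%:R <= x + 1.
Proof.
move=> x0; have /andP[a b] := truncn_itv x0.
by exists (truncn x).+1; rewrite b -natr1 lerD2r.
Qed.

Lemma half_small_ge d n : 0 < d -> exists2 j, (0 < j)%N & (2 ^+ (n + j))^-1 < d :> R.
Proof.
move=> d0; pose j := (Num.bound d^-1).+1; exists j => //.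
have H : d^-1 < j%:R.
  have H := archi_boundP (x := d^-1) ltac:(by rewrite invr_ge0 ltW).
  by apply: lt_trans H _; rewrite ltr_nat.
rewrite -[ltRHS]invrK ltf_pV2 ?posrE ?invr_gt0 ?exprn_gt0 //.
apply: lt_le_trans H _; rewrite -natrX ler_nat.
by apply: leq_trans (ltnW (ltn_expl _ (isT : 1 < 2)%N)) _; rewrite leq_exp2l // leq_addl.
Qed.

(** The three times are approximated on a fine dyadic grid: the first from the left, because a left
    limit is taken there, the other two from the right. *)
Lemma wM_chain f th n S : cadlag f -> f 0 = 0 -> (forall m, 0 <= th m) ->
  adjacent_btw f th n -> (forall j, chain_bound th n j <= S) -> 0 <= S ->
  (wM f (2 ^+ n)^-1 <= S%:E)%E.
Proof.
move=> cf f0 th0 H HS S0.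
apply: ge_ereal_sup => _ [t1 [t [t2 [/andP[t10 t1t] /andP[tt2 t21] td ->]]]].
rewrite lee_fin Mdist_le S0 /=; apply: btw_closed => e e0.
have e2 : 0 < e / 2 by lra.
have t101 : 0 <= t1 <= 1 by lra.
have t01 : 0 <= t <= 1 by lra.
have t201 : 0 <= t2 <= 1 by lra.
rewrite ger0_norm in td; last lra.
have [d1 d10 H1] := ext_left cf t101 e2.
have [d2 d20 H2] := ext_right t cf e2.
have [d3 d30 H3] := ext_right t2 cf e2.
pose g := (2 ^+ n)^-1 - (t2 - t1).
have g0 : 0 < g / 2 by rewrite divr_gt0 // subr_gt0.
(* The mesh must respect the three approximation windows, the gap from [t] to [t2] that keeps the
   indices ordered, half of the spare span on either side, and the room between [t2] and [1]. *)
pose d := Num.min (Num.min (Num.min d1 d2) (Num.min d3 (t2 - t)))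
  (Num.min (g / 2) (if t2 < 1 then 1 - t2 else 1)).
have d0 : 0 < d.
  by rewrite !lt_min d10 d20 d30 g0 /=; case: ifPn => ?; lra.
have [j j0 hj] := half_small_ge n d0.
have [hd1 hd2 hd3 hd4 [hd5 hd6]] : [/\ d <= d1, d <= d2, d <= d3, d <= t2 - t &
    d <= g / 2 /\ d <= if t2 < 1 then 1 - t2 else 1].
  by rewrite /d !ge_min !lexx !orbT.
pose h : R := (2 ^+ (n + j))^-1.
have {}hj : h < d by [].
have hpos : 0 < h by rewrite invr_gt0 exprn_gt0.
have pE : 2 ^+ (n + j) * h = 1 :> R by rewrite mulfV // expf_neq0.
have dyadE k : dyad (n + j) k = k%:R * h by [].
have above (x : R) : 0 <= x -> exists k, x < dyad (n + j) k <= x + h.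
  move=> x0; have [|k /andP[a b]] := @nat_above (x * 2 ^+ (n + j)).
    by rewrite mulr_ge0 ?exprn_ge0.
  exists k; rewrite dyadE; rewrite -(ltr_pM2r hpos) -mulrA pE mulr1 in a.
  by rewrite -(ler_pM2r hpos) mulrDl -mulrA pE mulr1 mul1r in b; rewrite a.
have below (x : R) : 0 < x -> exists k, x - h <= dyad (n + j) k < x.
  move=> x0; have [|k /andP[a b]] := @nat_below (x * 2 ^+ (n + j)).
    by rewrite mulr_gt0 ?exprn_gt0.
  exists k; rewrite dyadE; rewrite -(ltr_pM2r hpos) -[ltRHS]mulrA pE mulr1 in a.
  rewrite -(ler_pM2r hpos) -mulrA pE mulr1 -natr1 mulrDl mul1r in b.
  by rewrite a andbT lerBlDr.
have dyad_ge0 k : 0 <= dyad (n + j) k by rewrite dyadE mulr_ge0 // ltW.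
have dyad_le k l : dyad (n + j) k <= dyad (n + j) l -> (k <= l)%N.
  by rewrite !dyadE ler_pM2r // ler_nat.
have top : dyad (n + j) (2 ^ (n + j)) = 1 by rewrite dyadE natrX.
have [k1 [k1l k1r k1E]] : exists k1 : nat, [/\ t1 - h <= dyad (n + j) k1,
    dyad (n + j) k1 <= t1 & `|f (dyad (n + j) k1) - leftlim f t1| < e / 2].
  (* At time [0] the index [0] is used: [f 0 = 0] agrees with the convention for the left limit. *)
  have [t1E|t1N] := eqVneq t1 0.
    exists 0%N; rewrite dyadE mul0r t1E f0 /leftlim lexx subrr normr0.
    by split => //; lra.
  have [k /andP[a b]] := below t1 ltac:(by rewrite lt_neqAle eq_sym t1N).
  exists k; split; [by []|exact: ltW|].
  rewrite -[f (dyad _ _)](@ext01 _ f); last by rewrite dyad_ge0; lra.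
  by apply: H1 => //; lra.
have [k2 /andP[k2l k2r]] := above t (andP t01).1.
have dyad2 : 0 <= dyad (n + j) k2 <= 1 by rewrite dyad_ge0; lra.
have k2E : `|f (dyad (n + j) k2) - f t| < e / 2.
  by rewrite -(ext01 f dyad2) -(ext01 f t01); apply: H2 => //; lra.
have [k3 [k3l k3r k3d k3E]] : exists k3 : nat, [/\ t2 <= dyad (n + j) k3,
    dyad (n + j) k3 <= t2 + h, dyad (n + j) k3 <= 1 & `|f (dyad (n + j) k3) - f t2| < e / 2].
  have [t2E|t2N] := eqVneq t2 1.
    by exists (2 ^ (n + j))%N; rewrite top t2E subrr normr0; split => //; lra.
  have t2lt : t2 < 1 by rewrite lt_neqAle t2N.
  rewrite t2lt in hd6.
  have [k /andP[a b]] := above t2 (andP t201).1.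
  have d01 : 0 <= dyad (n + j) k <= 1 by rewrite dyad_ge0 /=; lra.
  exists k; split; [exact: ltW|by []|by case/andP: d01|].
  by rewrite -(ext01 f d01) -(ext01 f t201); apply: H3 => //; lra.
have k12 : (k1 <= k2)%N by apply: dyad_le; lra.
have k23 : (k2 <= k3)%N by apply: dyad_le; lra.
have k3top : (k3 <= 2 ^ (n + j))%N by apply: dyad_le; rewrite top.
have span : (k3 - k1 <= (2 ^ j).+1)%N.
  have hE : (2 ^ j)%:R * h = (2 ^+ n)^-1.
    by rewrite natrX /h exprD invfM mulrCA mulfV ?expf_neq0 // mulr1.
  apply/leqW/ltnW; rewrite -(ltr_nat R) natrB ?(leq_trans k12) // -(ltr_pM2r hpos).
  by rewrite hE mulrBl -!dyadE; rewrite /g in hd5; lra.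
have := dyad_chain th0 H k12 k23 k3top span.
move=> /(btw_mono (HS j)); exact: btw_near.
Qed.

End DyadicChaining.

(** * Probability estimates *)

Section LogAsymptotics.
Context {R : realType} {d : measure_display} {T : measurableType d}.
Variables (P : probability T R) (gam : R).
Hypothesis gam0 : 0 < gam.
Implicit Types (A : R -> set T) (L e : R).

Lemma Pout_le (A B : set T) : measurable B -> A `<=` B -> (Pout P A <= P B)%E.
Proof. by move=> mB AB; apply: ereal_inf_lbound; exists B. Qed.

Lemma le_Pout (A B : set T) : A `<=` B -> (Pout P A <= Pout P B)%E.
Proof.
move=> AB; apply: ereal_inf_le_tmp => _ [C [mC BC] <-].
by exists C => //; split => //; exact: subset_trans BC.
Qed.

Lemma Pout_setU (A B : set T) (x : R) : (Pout P A < x%:E)%E -> (Pout P B < x%:E)%E ->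
  (Pout P (A `|` B) <= (2 * x)%:E)%E.
Proof.
move=> /ereal_inf_lt[_ [A' [mA' AA'] <-] Ax] /ereal_inf_lt[_ [B' [mB' BB'] <-] Bx].
apply: le_trans (Pout_le (B := A' `|` B') _ _) _.
- exact: measurableU.
- by move=> w [/AA'|/BB']; [left|right].
- apply: le_trans (measureU2 _ _ _) _ => //.
  by rewrite mulrDl mul1r EFinD leeD // ltW.
Qed.

Lemma eln_le_expR (p : \bar R) (y : R) : (p <= (expR y)%:E)%E -> (eln p <= y%:E)%E.
Proof.
case: p => [r| |] //=; rewrite ?leey ?leNye // !lee_fin.
case: ifPn => [r0 ry|_ _]; last exact: leNye.
by rewrite lee_fin -(expRK y) ler_ln // posrE expR_gt0.
Qed.

Lemma expR_of_eln (p : \bar R) (y : R) : (eln p <= y%:E)%E -> (p <= (expR y)%:E)%E.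
Proof.
case: p => [r| |] //=; rewrite ?leNye //; case: ifPn => [r0|].
  by rewrite !lee_fin => ry; rewrite -(lnK r0) ler_expR.
by rewrite -leNgt => r0 _; rewrite lee_fin (le_trans r0) // expR_ge0.
Qed.

Lemma limf_esup_le (f : R -> \bar R) (F : set_system R) (c : \bar R) :
  F [set x | (f x <= c)%E] -> (limf_esup f F <= c)%E.
Proof.
move=> Fc; rewrite limf_esupE; apply: ge_ereal_inf.
exists (ereal_sup (f @` [set x | (f x <= c)%E])); first by exists [set x | (f x <= c)%E].
by apply: ge_ereal_sup => _ [x ? <-].
Qed.

Lemma limf_esup_lt (f : R -> \bar R) (F : set_system R) (c : \bar R) : Filter F ->
  (limf_esup f F < c)%E -> F [set x | (f x < c)%E].
Proof.
move=> FF; rewrite limf_esupE => /ereal_inf_lt[_ [V FV <-] Vc].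
apply: filterS FV => x Vx; apply: le_lt_trans Vc.
by apply: ereal_sup_ubound; exists x.
Qed.

Lemma powRN_large (K : R) : \forall eps \near 0^'+, K <= eps `^ (- gam).
Proof.
pose K' := Num.max K 1.
have K'1 : 1 <= K' by rewrite le_max lexx orbT.
have K'0 : 0 < K' by lra.
have KK' : K <= K' by rewrite le_max lexx.
near=> eps.
have e0 : 0 < eps by near: eps; exact: nbhs_right_gt.
apply: le_trans KK' _; rewrite powRN -[leLHS]invrK lef_pV2 ?posrE ?invr_gt0 ?powR_gt0 //.
have -> : K'^-1 = (K'^-1 `^ gam^-1) `^ gam.
  by rewrite -powRrM mulVf ?gt_eqF // powRr1 // invr_ge0 ltW.
apply: ge0_ler_powR; rewrite ?nnegrE ?powR_ge0 // ?ltW //.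
near: eps; apply: nbhs_right_lt; rewrite powR_gt0 ?invr_gt0 //.
Unshelve. all: by end_near. Qed.

(** The limsup bound without logarithms and infinite values; the slack [e] absorbs constant
    factors. *)
Definition exp_small A L := forall e, 0 < e -> \forall eps \near 0^'+,
  (Pout P (A eps) <= (expR (- (L - e) * eps `^ (- gam)))%:E)%E.

Lemma exp_smallP A L : exp_small A L <->
  (limf_esup (fun eps => (eps `^ gam)%:E * eln (Pout P (A eps))) 0^'+ <= (- L)%:E)%E.
Proof.
split=> [H|H e e0].
  apply/lee_addgt0Pr => e e0; apply: limf_esup_le; rewrite -EFinD.
  have := H e e0; apply: filterS2 (nbhs_right_gt (0 : R)) => eps eps0 /eln_le_expR He.
  have p0 : 0 < eps `^ gam by rewrite powR_gt0.
  apply: (@le_trans _ _ ((eps `^ gam)%:E * (- (L - e) * eps `^ (- gam))%:E)%E).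
    by apply: lee_wpmul2l => //; rewrite lee_fin ltW.
  by rewrite -EFinM lee_fin powRN mulrCA mulfV ?gt_eqF // mulr1 opprB addrC.
have Le : (limf_esup (fun eps => (eps `^ gam)%:E * eln (Pout P (A eps))) 0^'+
    < (- L + e)%:E)%E by apply: le_lt_trans H _; rewrite lte_fin; lra.
have H2 : \forall eps \near 0^'+,
    ((eps `^ gam)%:E * eln (Pout P (A eps)) < (- L + e)%:E)%E by exact: limf_esup_lt Le.
apply: filterS2 (nbhs_right_gt (0 : R)) H2 => eps eps0 He; apply: expR_of_eln.
have p0 : 0 < eps `^ (- gam) by rewrite powR_gt0.
have -> : eln (Pout P (A eps)) =
    ((eps `^ (- gam))%:E * ((eps `^ gam)%:E * eln (Pout P (A eps))))%E.
  by rewrite muleA -EFinM powRN mulVf ?mul1e // gt_eqF // powR_gt0.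
apply: (@le_trans _ _ ((eps `^ (- gam))%:E * (- L + e)%:E)%E).
  by apply: lee_wpmul2l; rewrite ?lee_fin ltW.
by rewrite -EFinM lee_fin mulrC opprB addrC.
Qed.

(** As [eps] to the power [- gam] tends to infinity, [K] is eventually below the exponential of [e]
    times that power, by [1 + x <= expR x]. *)
Lemma exp_small_near A L K : 0 < K ->
  (\forall eps \near 0^'+, (Pout P (A eps) <= (K * expR (- L * eps `^ (- gam)))%:E)%E) ->
  exp_small A L.
Proof.
move=> K0 H e e0; apply: filterS2 H (powRN_large (K / e)) => eps He large.
apply: le_trans He _; rewrite lee_fin.
have -> : - (L - e) * eps `^ (- gam) = e * eps `^ (- gam) + - L * eps `^ (- gam).
  by ring.
rewrite expRD ler_pM2r ?expR_gt0 //; apply: le_trans (expR_ge1Dx _).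
by rewrite ler_pdivrMr // mulrC in large; apply: le_trans large _; rewrite lerDr.
Qed.

Lemma exp_small_sub A A' L : (forall eps, 0 < eps -> A eps `<=` A' eps) ->
  exp_small A' L -> exp_small A L.
Proof.
move=> sub H e e0; apply: filterS2 (nbhs_right_gt (0 : R)) (H e e0) => eps eps0 He.
exact: le_trans (le_Pout (sub _ eps0)) He.
Qed.

Lemma exp_small_setU A A' L : exp_small A L -> exp_small A' L ->
  exp_small (fun eps => A eps `|` A' eps) L.
Proof.
move=> H H' e e0; have e2 : 0 < e / 2 by lra.
suff : exp_small (fun eps => A eps `|` A' eps) (L - e / 2).
  move=> /(_ _ e2); apply: filterS => eps.
  by rewrite (_ : L - e / 2 - e / 2 = L - e) //; field.
(* The other half of the slack absorbs the factor [4]: doubling makes the bounds strict, as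
   [Pout_setU] requires, and there are two sets. *)
apply: (@exp_small_near _ _ 4) => //.
apply: filterS2 (H _ e2) (H' _ e2) => eps He He'.
set y := expR _ in He He' *; have y0 : 0 < y by exact: expR_gt0.
apply: le_trans (Pout_setU (x := 2 * y) _ _) _.
- by apply: le_lt_trans He _; rewrite lte_fin; lra.
- by apply: le_lt_trans He' _; rewrite lte_fin; lra.
- by rewrite lee_fin; lra.
Qed.

Lemma exp_small_set0 L : exp_small (fun=> set0) L.
Proof.
move=> e e0; apply: nearW => eps; apply: (@le_trans _ _ (P set0)).
  exact: Pout_le.
by rewrite measure0 lee_fin expR_ge0.
Qed.

Lemma exp_small_bigcup (A : nat -> R -> set T) L n :
  (forall i, (i < n)%N -> exp_small (A i) L) ->
  exp_small (fun eps => \bigcup_(i in `I_n) A i eps) L.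
Proof.
elim: n => [|n IH] H.
  by apply: exp_small_sub (exp_small_set0 L) => eps _ w [].
apply: exp_small_sub (exp_small_setU (IH (fun i h => H i (ltnW h))) (H n (ltnSn n))).
move=> eps _ w [i /= +]; rewrite ltnS leq_eqVlt => /orP[/eqP ->|im Aw]; first by right.
by left; exists i.
Qed.

End LogAsymptotics.

Section ChernoffBound.
Context {R : realType} {d : measure_display} {T : measurableType d}.
Variable P : probability T R.

Lemma chernoff (Y : T -> R) (lam x : R) : measurable_fun setT Y -> 0 < lam ->
  (P [set w | (x < Y w)%R] <=
     (expR (- (lam * x)))%:E * \int[P]_w (expR (lam * Y w))%:E)%E.
Proof.
move=> mY lam0; pose A := [set w | x < Y w].
have mA : measurable A.
  have -> : A = setT `&` Y @^-1` `]x, +oo[%classic.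
    by apply/seteqP; split => w /=; rewrite in_itv /= andbT; [split|case].
  exact: mY.
have mexp : measurable_fun setT (EFin \o (fun w => expR (lam * Y w))).
  apply/measurable_EFinP; apply: measurableT_comp => //.
  exact: measurable_funM.
have e0 : 0 < expR (lam * x) by exact: expR_gt0.
have -> : P A = ((expR (- (lam * x)))%:E * \int[P]_(w in A) (cst (expR (lam * x))%:E w))%E.
  by rewrite integral_cst // muleA -EFinM expRN mulVf ?gt_eqF // mul1e.
apply: lee_wpmul2l; first by rewrite lee_fin expR_ge0.
apply: (@le_trans _ _ (\int[P]_(w in A) (expR (lam * Y w))%:E)%E).
  apply: ge0_le_integral => //.
  - by move=> w _; rewrite lee_fin ltW.
  - exact: measurable_funTS.
  - by move=> w /= Aw; rewrite lee_fin ler_expR ler_pM2l // ltW.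
by apply: ge0_subset_integral.
Qed.

Lemma measurable_Mdist (f g h : T -> R) : measurable_fun setT f ->
  measurable_fun setT g -> measurable_fun setT h ->
  measurable_fun setT (fun w => Mdist (f w) (g w) (h w)).
Proof.
move=> mf mg mh; apply: measurable_maxr; first exact: measurable_cst.
apply: measurable_maxr; apply: measurable_funB => //.
  exact: measurable_minr.
exact: measurable_maxr.
Qed.

End ChernoffBound.

Section PowersOfTwo.
Context {R : realType}.

Lemma powRD_gt0 (x r s : R) : 0 < x -> x `^ (r + s) = x `^ r * x `^ s.
Proof. by move=> x0; rewrite powRD // (gt_eqF x0) implybT. Qed.

Lemma powR2E (x : R) : 2 `^ x = expR (x * ln 2).
Proof. by rewrite /powR gt_eqF. Qed.

Lemma ln2_gt0 : 0 < ln 2 :> R.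
Proof. by rewrite ln_gt0 // ltr1n. Qed.

Lemma powR2_nat n : 2 `^ (- n%:R) = (2 ^+ n)^-1 :> R.
Proof. by rewrite powRN powR_mulrn. Qed.

Lemma powR2_large (g : R) (K : R) : 0 < g -> exists N0, forall N : nat, (N0 <= N)%N ->
  K <= 2 `^ (N%:R * g).
Proof.
move=> g0; have gl : 0 < g * ln 2 by rewrite mulr_gt0 // ln2_gt0.
exists (Num.bound (`|K| / (g * ln 2))) => N hN; rewrite powR2E.
apply: le_trans (expR_ge1Dx _); apply: (@le_trans _ _ (N%:R * g * ln 2)); last by rewrite lerDr.
rewrite -mulrA -ler_pdivrMr //; have := archi_boundP (x := `|K| / (g * ln 2)) ltac:(by rewrite divr_ge0 // ltW).
move=> /ltW H; apply: (@le_trans _ _ (`|K| / (g * ln 2))).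
  by rewrite ler_pM2r ?invr_gt0 // ler_norm.
by apply: le_trans H _; rewrite ler_nat.
Qed.

(** Prepares the union bound: doubly exponential decay beats both the number [2 ^ m] of triples of a
    level and a further factor [2 ^ m.+1], which makes the levels summable. *)
Lemma superexponential (c g : R) : 0 < c -> 0 < g -> exists2 K, 0 < K & forall m : nat,
  (2 ^ m)%:R * c * expR (- (2 `^ (m%:R * g) / 2)) <= K / (2 ^ m.+1)%:R.
Proof.
move=> c0 g0; pose b := 2 / g; have b0 : 0 < b by rewrite divr_gt0.
(* With this [b] the square of [2 ^ m] is [expR (b * y)], and the constant comes from
   [b * y <= y ^+ 2 / 8 + 2 * b ^+ 2]. *)
exists (2 * c * expR (2 * b ^+ 2)) => [|m]; first by rewrite !mulr_gt0 ?expR_gt0.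
rewrite ler_pdivlMr ?ltr0n ?expn_gt0 //.
pose y := m%:R * g * ln 2.
have y0 : 0 <= y by rewrite !mulr_ge0 // ltW // ln2_gt0.
have by_ : (2 ^ m)%:R * (2 ^ m)%:R = expR (b * y).
  rewrite -natrM -expnD addnn natrX -powR_mulrn // powR2E; congr expR.
  by rewrite /b /y -muln2 natrM; field; rewrite gt_eqF.
have -> : (2 ^ m)%:R * c * expR (- (2 `^ (m%:R * g) / 2)) * (2 ^ m.+1)%:R =
    2 * c * (expR (b * y) * expR (- (2 `^ (m%:R * g) / 2))).
  by rewrite -by_ expnS natrM; ring.
rewrite ler_pM2l ?mulr_gt0 // -expRD ler_expR powR2E -/y.
have e1 := expR_ge1Dx (y / 2).
have : (y / 2) ^+ 2 <= expR y.
  have -> : expR y = expR (y / 2) ^+ 2 by rewrite expr2 -expRD; congr expR; field.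
  by rewrite ler_pXn2r ?nnegrE ?expR_ge0 ?divr_ge0 //; lra.
have : 0 <= (y / 2 - 2 * b) ^+ 2 by exact: sqr_ge0.
by rewrite !expr2; lra.
Qed.

End PowersOfTwo.

(** * From exponential moments to the oscillation bound *)

Section OscillationBound.
Context {R : realType} {d : measure_display} {T : measurableType d}.
Variables (P : probability T R) (alpha beta c C : R) (X : R -> T -> R -> R).
Hypotheses (alpha1 : 1 < alpha) (beta0 : 0 < beta) (beta_lt : beta < alpha^-1).
Hypothesis c0 : 0 < c.
Hypothesis Xcadlag : forall eps, 0 < eps -> forall w, cadlag (X eps w).
Hypothesis Xmeas : forall eps, 0 < eps -> forall t, measurable_fun setT (fun w => X eps w t).
Hypothesis X0 : forall eps, 0 < eps -> forall w, X eps w 0 = 0.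
Hypothesis Xmoment : forall lam eps t1 t t2, 0 < lam -> 0 < eps ->
  0 <= t1 -> t1 <= t -> t <= t2 -> t2 <= 1 ->
  (\int[P]_w (expR (lam * Mdist (X eps w t1) (X eps w t) (X eps w t2)))%:E
   <= (c * expR (C * (lam * eps) `^ alpha * `|t2 - t1|))%:E)%E.

Let alpha' := alpha / (alpha - 1).
Let gam := alpha^-1 - beta.
Let th (m : nat) : R := 2 `^ (- (m%:R * beta)).

Let alpha0 : 0 < alpha := lt_trans ltr01 alpha1.

Let alpha'0 : 0 < alpha'.
Proof. by apply: divr_gt0; rewrite ?subr_gt0. Qed.

Let gam0 : 0 < gam.
Proof. by rewrite subr_gt0. Qed.

Definition large_triple eps (m k : nat) : set T := [set w | th m <
  Mdist (X eps w (dyad m k)) (X eps w (dyad m k.+1)) (X eps w (dyad m k.+2))].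

Lemma measurable_large_triple eps m k : 0 < eps -> measurable (large_triple eps m k).
Proof.
move=> e0; have := measurable_Mdist (Xmeas e0 (dyad m k)) (Xmeas e0 (dyad m k.+1))
  (Xmeas e0 (dyad m k.+2)).
move=> mM; rewrite (_ : large_triple _ _ _ = setT `&` (fun w => Mdist (X eps w (dyad m k))
  (X eps w (dyad m k.+1)) (X eps w (dyad m k.+2))) @^-1` `]th m, +oo[%classic).
  exact: mM.
by apply/seteqP; split => w /=; rewrite in_itv /= andbT; [split|case].
Qed.

(* The exponential moment is taken at [lam = eps ^ (- alpha') * 2 ^ (m / alpha)], for
   which [(lam * eps) ^ alpha = eps ^ (- alpha') * 2 ^ m]. *)
Lemma large_triple_prob eps m k : 0 < eps -> (k.+2 <= 2 ^ m)%N ->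
  (P (large_triple eps m k) <=
    (c * expR (- (eps `^ (- alpha') * (2 `^ (m%:R * gam) - 2 * C))))%:E)%E.
Proof.
move=> e0 km; set s := eps `^ (- alpha').
have s0 : 0 < s by rewrite powR_gt0.
have a0 : alpha != 0 by rewrite gt_eqF.
have a1 : alpha - 1 != 0 by rewrite subr_eq0 gt_eqF.
have p0 : 0 < 2 ^+ m :> R by rewrite exprn_gt0.
pose lam := s * 2 `^ (m%:R / alpha).
have lam0 : 0 < lam by rewrite mulr_gt0 // powR_gt0.
have q0 : 0 < 2 `^ (m%:R / alpha) :> R by rewrite powR_gt0.
have h1 : (lam * eps) `^ alpha = s * 2 ^+ m.
  rewrite /lam /s mulrAC -{2}[eps]powRr1 ?(ltW e0) // -powRD_gt0 //.
  rewrite powRM ?powR_ge0 // -!powRrM divfK // powR_mulrn //; congr (_ `^ _ * _).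
  by rewrite /alpha'; field.
have h2 : lam * th m = s * 2 `^ (m%:R * gam).
  rewrite /lam /th -mulrA -powRD_gt0 //.
  by congr (_ * 2 `^ _); rewrite /gam; ring.
have dk i j : (i <= j)%N -> dyad m i <= dyad m j :> R.
  by move=> ij; rewrite /dyad ler_pM2r ?invr_gt0 // ler_nat.
have h3 : `|dyad m k.+2 - dyad m k| = 2 / 2 ^+ m :> R.
  by rewrite /dyad -mulrBl -!natr1 (_ : _ - _ = 2) ?ger0_norm ?divr_ge0 ?ltW //; ring.
have mM := measurable_Mdist (Xmeas e0 (dyad m k)) (Xmeas e0 (dyad m k.+1))
  (Xmeas e0 (dyad m k.+2)).
have := chernoff P (th m) mM lam0; rewrite h2 => H.
apply: le_trans H _.
apply: (@le_trans _ _ ((expR (- (s * 2 `^ (m%:R * gam))))%:E *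
   (c * expR (C * (lam * eps) `^ alpha * `|dyad m k.+2 - dyad m k|))%:E)%E).
  apply: lee_wpmul2l; first by rewrite lee_fin expR_ge0.
  apply: Xmoment => //.
  - by rewrite /dyad divr_ge0 // ltW.
  - exact: dk.
  - exact: dk.
  - by rewrite /dyad ler_pdivrMr // mul1r -natrX ler_nat.
rewrite h1 h3 -EFinM lee_fin mulrCA ler_pM2l // -expRD ler_expR.
rewrite (_ : C * (s * 2 ^+ m) * (2 / 2 ^+ m) = 2 * C * s); last by field; rewrite gt_eqF.
by lra.
Qed.

(** The conditional discards triples that leave [[0, 1]] while keeping an index set of size
    [2 ^ m]. *)
Definition bad_level eps m := \big[setU/set0]_(k < 2 ^ m)
  (if (k.+2 <= 2 ^ m)%N then large_triple eps m k else set0).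

Lemma measurable_bad_level eps m : 0 < eps -> measurable (bad_level eps m).
Proof.
move=> e0; apply: bigsetU_measurable => k _.
by case: ifPn => _; [exact: measurable_large_triple|exact: measurable0].
Qed.

Lemma bad_level_prob eps m : 0 < eps -> (P (bad_level eps m) <=
  ((2 ^ m)%:R * (c * expR (- (eps `^ (- alpha') * (2 `^ (m%:R * gam) - 2 * C)))))%:E)%E.
Proof.
move=> e0; set y := c * _.
pose A (k : nat) := if (k.+2 <= 2 ^ m)%N then large_triple eps m k else set0.
have mA k : measurable (A k).
  by rewrite /A; case: ifPn => _; [exact: measurable_large_triple|exact: measurable0].
apply: le_trans (Boole_inequality P (A := A) (fun i _ => mA i)) _.
apply: (@le_trans _ _ (\sum_(k < 2 ^ m) y%:E)%E).
  apply: lee_sum => k _; rewrite /A; case: ifPn => [km|_].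
    exact: large_triple_prob.
  by rewrite measure0 lee_fin /y mulr_ge0 ?expR_ge0 // ltW.
by rewrite sumEFin sumr_const card_ord mulr_natl.
Qed.

Definition bad N eps := \bigcup_m (if (N < m)%N then bad_level eps m else set0).

Lemma measurable_bad N eps : 0 < eps -> measurable (bad N eps).
Proof.
move=> e0; apply: bigcup_measurable => m _.
by case: ifPn => _; [exact: measurable_bad_level|exact: measurable0].
Qed.

(** The exponent of level [m] is split in halves. One is compared with level [N] and gives the rate;
    the other makes the sum over levels converge uniformly in [eps]. *)
Lemma bad_prob : exists2 K, 0 < K & forall N eps, 0 < eps -> 1 <= eps `^ (- alpha') ->
  (P (bad N eps) <=
    (K * expR (- (2 `^ (N%:R * gam) / 2 - 2 * C) * eps `^ (- alpha')))%:E)%E.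
Proof.
have [K K0 HK] := superexponential c0 gam0; exists K => // N eps e0 s1.
move: (measurable_bad_level) (bad_level_prob).
set s := eps `^ (- alpha') in s1 *; set x := K * _.
have x0 : 0 <= x by rewrite mulr_ge0 ?expR_ge0 // ltW.
move=> mb bp.
apply: le_trans (generalized_Boole_inequality P _ _) _.
- by move=> m; case: ifPn => _; [exact: mb|exact: measurable0].
- exact: measurable_bad.
apply: le_trans (epsilon_trick0 xpredT x0).
apply: lee_nneseries => m _; first by [].
case: ifPn => [Nm|_]; last by rewrite measure0 lee_fin divr_ge0.
apply: le_trans (bp _ _ e0) _; rewrite lee_fin -/s.
have q : 2 `^ (N%:R * gam) <= 2 `^ (m%:R * gam) :> R.
  by rewrite ler_powR ?ler1n // ler_pM2r // ler_nat ltnW.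
have t0 : 0 <= 2 `^ (N%:R * gam) :> R by exact: powR_ge0.
have := HK m; set t := 2 `^ (m%:R * gam) in q *; set tN := 2 `^ _ in x x0 q t0 *.
move=> H; rewrite /x mulrAC; apply: le_trans (ler_wpM2r (expR_ge0 _) H).
rewrite -!mulrA ler_pM2l ?ltr0n ?expn_gt0 // ler_pM2l // -expRD ler_expR.
(* Half of each of the two products gives [s * t >= t / 2 + s * tN / 2]. *)
have : (s - 1) * t >= 0 by apply: mulr_ge0; lra.
have : s * (t - tN) >= 0 by apply: mulr_ge0; lra.
by lra.
Qed.

Lemma chain_bound_geometric n j :
  chain_bound th n j <= 2 * th n / (1 - 2 `^ (- beta)).
Proof.
set q := 2 `^ (- beta).
have q0 : 0 < q by rewrite powR_gt0.
have q1 : q < 1.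
  rewrite /q powR2E -[ltRHS]expR0 ltr_expR mulNr oppr_lt0 mulr_gt0 ?ln2_gt0 //.
have thS m : th m.+1 = th m * q.
  rewrite /th /q -powRD_gt0 //.
  by congr (2 `^ _); rewrite -natr1; ring.
have thn : 0 < th n by rewrite powR_gt0.
have thD i : th (n + i) = th n * q ^+ i.
  elim: i => [|i IH]; first by rewrite addn0 expr0 mulr1.
  by rewrite addnS thS IH exprSr mulrA.
(* The geometric remainder is kept so that the induction telescopes. *)
suff : chain_bound th n j <= 2 * th n / (1 - q) - 2 * th n / (1 - q) * q ^+ j.+1.
  move=> H; apply: le_trans H _; rewrite gerBl.
  by rewrite mulr_ge0 ?exprn_ge0 ?divr_ge0 ?mulr_ge0 ?subr_ge0 // ltW.
elim: j => [|j IH].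
  rewrite /chain_bound big_ord0 addr0 expr1 -{1}[_ / _]mulr1 -mulrBr divfK; first by lra.
  by rewrite gt_eqF // subr_gt0.
rewrite /chain_bound big_ord_recr /= addrA -/(chain_bound th n j) thD.
have -> : 2 * (th n * q ^+ j.+1) =
    2 * th n / (1 - q) * q ^+ j.+1 - 2 * th n / (1 - q) * q ^+ j.+2.
  by rewrite [q ^+ j.+2]exprS; field; rewrite gt_eqF // subr_gt0.
by lra.
Qed.

Lemma wM_good N eps w n : 0 < eps -> ~ bad N eps w -> (N < n)%N ->
  (wM (X eps w) (2 `^ (- n%:R)) <= (2 * th n / (1 - 2 `^ (- beta)))%:E)%E.
Proof.
move=> e0 good Nn; rewrite powR2_nat.
apply: (wM_chain (th := th)).
- exact: Xcadlag.
- exact: X0.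
- by move=> m; exact: powR_ge0.
- move=> m k nm km; suff : Mdist (X eps w (dyad m k)) (X eps w (dyad m k.+1))
    (X eps w (dyad m k.+2)) <= th m by rewrite Mdist_le => /andP[].
  rewrite leNgt; apply/negP => H; apply: good; exists m => //.
  rewrite (leq_trans Nn nm) /bad_level.
  have k2 : (k < 2 ^ m)%N by apply: leq_trans km; exact: leqW.
  rewrite (bigD1 (Ordinal k2)) //= km; left; exact: H.
- exact: chain_bound_geometric.
- apply: le_trans (chain_bound_geometric n 0).
  by rewrite /chain_bound big_ord0 addr0 powR_ge0.
Qed.

Definition large_oscillation N eps : set T := [set w | exists n : nat, (N < n)%N /\
  ((2 * (2 `^ (- (n%:R * beta))) / (1 - 2 `^ (- beta)))%:E
     < wM (X eps w) (2 `^ (- n%:R)))%E].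

Lemma large_oscillation_small N :
  exp_small P alpha' (large_oscillation N) (2 `^ (N%:R * gam) / 2 - 2 * C).
Proof.
have [K K0 HK] := bad_prob; apply: (exp_small_near alpha'0 K0).
apply: filterS2 (nbhs_right_gt (0 : R)) (powRN_large alpha'0 1) => eps e0 s1.
apply: le_trans (Pout_le P (measurable_bad N e0) _) (HK N eps e0 s1).
move=> w [n [Nn Hn]]; apply: contrapT => good; move: Hn; rewrite ltNge => /negP; apply.
have := wM_good e0 good Nn; by rewrite /th.
Qed.

Lemma large_oscillation_cvg : (fun N => limf_esup (fun eps =>
    ((eps `^ alpha')%:E * eln (Pout P (large_oscillation N eps)))%E) 0^'+)
  @ \oo --> -oo%E.
Proof.
apply/cvgeNyPle => A.
have [N0 HN0] := powR2_large (2 * (- A + 2 * C)) gam0.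
exists N0 => // N /= NN.
apply: le_trans ((exp_smallP P _ _ _).1 (large_oscillation_small N)) _.
by rewrite lee_fin; have := HN0 N NN; lra.
Qed.

End OscillationBound.

(** * Uniform bounds and exponential tightness *)

Section UniformBound.
Context {R : realType}.
Implicit Types (f : R -> R) (p : nat -> R).

(** Inside a cell the modulus compares [f t] with the left limit at [p j], bounded through the
    earlier cells, and with the value at [p j.+1]; each cell adds one [eta]. *)
Lemma wM_sup_bound f p n b eta dl : cadlag f -> 0 <= b -> 0 <= eta ->
  (wM f dl <= eta%:E)%E -> p 0%N = 0 -> (forall j, 0 <= p j <= 1) ->
  (forall j, p j.+1 - p j < dl) -> (forall j, (j <= n)%N -> `|f (p j)| <= b) ->
  forall j, (j <= n)%N -> forall t, 0 <= t <= p j -> `|f t| <= b + j%:R * eta.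
Proof.
move=> cf b0 eta0 wf p0 p01 pdl pb; elim=> [|j IH] jn t /andP[t0 tp].
  have -> : t = p 0%N by rewrite p0 in tp *; lra.
  by rewrite mul0r addr0; exact: pb.
have {}IH := IH (ltnW jn).
have jeta : 0 <= j%:R * eta by rewrite mulr_ge0.
have Sj : j.+1%:R * eta = j%:R * eta + eta by rewrite -natr1 mulrDl mul1r.
have [tj|jt] := leP t (p j).
  by have := IH t; rewrite t0 tj => /(_ isT); rewrite Sj; lra.
have [->|tN] := eqVneq t (p j.+1); first by have := pb _ jn; rewrite Sj; lra.
have {tN}tlt : t < p j.+1 by rewrite lt_neqAle tN.
have llb : `|leftlim f (p j)| <= b + j%:R * eta.
  apply/ler_addgt0Pr => e e0; have [d d0 Hd] := ext_left cf (p01 j) e0.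
  have := Hd (p j - d / 2) ltac:(lra) ltac:(lra).
  have : `|ext f (p j - d / 2)| <= b + j%:R * eta.
    have [s0|s0] := ltP (p j - d / 2) 0; first by rewrite ext_lt0 // normr0 addr_ge0.
    rewrite ext01; first by apply: IH; rewrite s0 /=; lra.
    by have := p01 j; rewrite s0 /=; lra.
  by rewrite ltr_norml !ler_norml => /andP[? ?] /andP[? ?]; apply/andP; split; lra.
have : Mdist (leftlim f (p j)) (f t) (f (p j.+1)) <= eta.
  rewrite -lee_fin; apply: le_trans wf; apply: ereal_sup_ubound.
  have /andP[? ?] := p01 j; have /andP[? ?] := p01 j.+1.
  exists (p j), t, (p j.+1); split => //; [lra|lra|].
  by rewrite ger0_norm; [exact: pdl|lra].
rewrite Mdist_le => /andP[_]; have := pb _ jn; move: llb.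
rewrite Sj !ler_norml => /andP[? ?] /andP[? ?].
by move=> /andP[/orP[?|?] /orP[?|?]]; apply/andP; split; lra.
Qed.

(** A point of [Dd] is chosen in each open cell of length [1 / J], so neighbours are less than
    [2 / J] apart, and the sequence ends with [1]. The initial point [0] is not taken from [Dd]; the
    processes vanish there. *)
Lemma dense_grid (Dd : set R) dl : 0 < dl -> Dd `<=` `[0, 1]%classic ->
  closure Dd = `[0, 1]%classic -> Dd 1 ->
  exists p n, [/\ p 0%N = 0, p n = 1, forall j, 0 <= p j <= 1,
    forall j, p j.+1 - p j < dl & forall j, Dd (p j.+1)].
Proof.
move=> dl0 D01 Dcl D1.
have [J [Jpos Jdl]] : exists J : nat, (0 < J)%N /\ 2 / J%:R < dl.
  exists (Num.bound (2 / dl)).+1; split=> //.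
  rewrite ltr_pdivrMr ?ltr0n // mulrC -ltr_pdivrMr //.
  apply: lt_trans (archi_boundP (x := 2 / dl) _) _; first by rewrite divr_ge0 // ltW.
  by rewrite ltr_nat.
have J0 : 0 < J%:R :> R by rewrite ltr0n.
have pts (j : nat) : exists x, if (j < J)%N then
    Dd x /\ j%:R / J%:R < x < j.+1%:R / J%:R else x = 1.
  have [jJ|_] := boolP (j < J)%N; last by exists 1.
  pose x := (j%:R + 2^-1) / J%:R : R.
  have : closure Dd x.
    rewrite Dcl /= in_itv /=; apply/andP; split.
      by apply: divr_ge0 (ltW J0); apply: addr_ge0; rewrite ?invr_ge0 ?ler0n.
    rewrite /x ler_pdivrMr // mul1r; have : j.+1%:R <= J%:R :> R by rewrite ler_nat.
    by rewrite -natr1; lra.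
  have r0 : 0 < 2^-1 / J%:R :> R by rewrite divr_gt0.
  move=> /(_ _ (nbhsx_ballx x _ r0)) [y [Dy]]; rewrite /ball /= ltr_norml => /andP[y1 y2].
  have E1 : x = j%:R / J%:R + 2^-1 / J%:R by rewrite /x mulrDl.
  have E2 : j.+1%:R / J%:R = j%:R / J%:R + 2^-1 / J%:R + 2^-1 / J%:R :> R.
    by rewrite -natr1; field; rewrite gt_eqF.
  by exists y; split => //; rewrite E2; apply/andP; split; lra.
have [q Hq] := choice pts.
have qlt j : (j < J)%N -> Dd (q j) /\ j%:R / J%:R < q j < j.+1%:R / J%:R.
  by move=> jJ; have := Hq j; rewrite jJ.
have qge j : (J <= j)%N -> q j = 1 by move=> jJ; have := Hq j; rewrite ltnNge jJ.
have qD j : Dd (q j) by have [/qlt[]|/qge ->] := ltnP j J.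
exists (fun j => if j is k.+1 then q k else 0), J.+1; split => //.
- exact: qge.
- case=> [|j]; first by rewrite lexx ler01.
  by have := D01 _ (qD j); rewrite /= in_itv.
- have S (j : nat) : j.+1%:R / J%:R = j%:R / J%:R + J%:R^-1 :> R by rewrite -natr1 mulrDl mul1r.
  case=> [|j].
    by have [_ /andP[_ ]] := qlt 0%N Jpos; rewrite S mul0r; lra.
  have [j1J|Jj1] := ltnP j.+1 J.
    have [_ /andP[_ a]] := qlt _ j1J; have [_ /andP[b _]] := qlt _ (ltnW j1J).
    by rewrite !S in a; lra.
  rewrite (qge _ Jj1).
  have [jJ|Jj] := ltnP j J; last by rewrite (qge _ Jj) subrr.
  have [_ /andP[b _]] := qlt _ jJ; have jE : j.+1 = J by apply/eqP; rewrite eqn_leq jJ.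
  have : j.+1%:R / J%:R = 1 :> R by rewrite jE divff // gt_eqF.
  rewrite S; lra.
Qed.

End UniformBound.

Lemma compact_bound {R : realType} (K : set R) : compact K ->
  exists2 b, 0 <= b & forall x, K x -> `|x| <= b.
Proof.
move=> /compact_bounded[M [_ HM]]; exists (`|M| + 1) => [|x Kx].
  by rewrite addr_ge0.
apply: HM Kx; have := ler_norm M; lra.
Qed.

Theorem theorem2p2 (R : realType) (d : measure_display) (T : measurableType d)
  (P : probability T R) (alpha : R) (X : R -> T -> R -> R) :
  1 < alpha ->
  (forall eps, 0 < eps -> forall w, cadlag (X eps w)) ->
  (forall eps, 0 < eps -> forall t, measurable_fun setT (fun w => X eps w t)) ->
  (forall eps, 0 < eps -> forall w, X eps w 0 = 0) ->
  let alpha' := alpha / (alpha - 1) in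
  (exists c C : R, [/\ 0 < c, 0 < C &
     forall lam eps t1 t t2, 0 < lam -> 0 < eps ->
       0 <= t1 -> t1 <= t -> t <= t2 -> t2 <= 1 ->
       (\int[P]_w (expR (lam * Mdist (X eps w t1) (X eps w t) (X eps w t2)))%:E
         <= (c * expR (C * (lam * eps) `^ alpha * `|t2 - t1|))%:E)%E]) ->
  (forall beta, 0 < beta -> beta < alpha^-1 ->
     (fun N : nat => limf_esup (fun eps : R =>
        ((eps `^ alpha')%:E *
         eln (Pout P [set w | exists n : nat, (N < n)%N /\
              ((2 * (2 `^ (- (n%:R * beta))) / (1 - 2 `^ (- beta)))%:E
                 < wM (X eps w) (2 `^ (- n%:R)))%E]))%E) (0^'+))
       @ \oo --> -oo%E)
  /\
  (forall Dd : set R, countable Dd -> Dd `<=` `[0, 1]%classic ->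
     closure Dd = `[0, 1]%classic -> Dd 1 ->
     (forall q, Dd q -> exp_tight P (@compact R) (fun eps w => X eps w q) alpha') ->
     exp_tight P (@Dcompact R) X alpha').
Proof.
move=> alpha1 Xc Xm X0 alpha' [c [C [c0 _ Xmom]]].
have part1 beta : 0 < beta -> beta < alpha^-1 -> (fun N : nat => limf_esup (fun eps : R =>
    ((eps `^ alpha')%:E * eln (Pout P (large_oscillation beta X N eps)))%E) (0^'+))
    @ \oo --> -oo%E.
  by move=> b0 b1; exact: (large_oscillation_cvg alpha1 b0 b1 c0 Xc Xm X0 Xmom).
split=> [beta b0 b1|Dd _ D01 Dcl D1 Dtight Mc]; first exact: part1.
have alpha0 : 0 < alpha := lt_trans ltr01 alpha1.
have ai0 : 0 < alpha^-1 by rewrite invr_gt0.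
pose beta := alpha^-1 / 2.
have beta0 : 0 < beta by rewrite divr_gt0.
have beta1 : beta < alpha^-1 by rewrite /beta; lra.
have a'0 : 0 < alpha' by rewrite divr_gt0 // subr_gt0.
have [N _ /(_ N (leqnn N)) /= osc] := (cvgeNyPle _).1 (part1 beta beta0 beta1) (- Mc).
pose q := 2 `^ (- beta) : R.
have q1 : q < 1.
  by rewrite /q powR2E -[ltRHS]expR0 ltr_expR mulNr oppr_lt0 mulr_gt0 // ln2_gt0.
(* Indices start at [N.+1] because [large_oscillation] at [N] concerns the levels above [N]. *)
pose dl n : R := 2 `^ (- (N.+1 + n)%:R).
pose eta n : R := 2 * 2 `^ (- ((N.+1 + n)%:R * beta)) / (1 - q).
have dl0 n : 0 < dl n by rewrite powR_gt0.
have eta0 n : 0 <= eta n by rewrite divr_ge0 ?mulr_ge0 ?powR_ge0 // subr_ge0 ltW.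
have eta_small e : 0 < e -> exists n, eta n <= e.
  move=> e0; have [n0 Hn0] := powR2_large (2 / ((1 - q) * e)) beta0.
  exists n0; have := Hn0 (N.+1 + n0)%N (leq_addl _ _).
  have D0 : 0 < (1 - q) * e by rewrite mulr_gt0 // subr_gt0.
  have p0 : 0 < 2 `^ ((N.+1 + n0)%:R * beta) :> R by rewrite powR_gt0.
  rewrite ler_pdivrMr // => H; rewrite /eta powRN ler_pdivrMr ?subr_gt0 //.
  by rewrite ler_pdivrMr // mulrC [e * _]mulrC.
(* Consecutive points are closer than [dl 0], so the modulus of index [0] applies across each
   cell. *)
have [p [n [p0 pn p01 pdl pD]]] := dense_grid (dl0 0%N) D01 Dcl D1.
have tight j : exists b, 0 <= b /\
    exp_small P alpha' (fun eps => [set w | b < `|X eps w (p j.+1)|]) Mc.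
  have [K Kc HK] := Dtight _ (pD j) Mc; have [b b0 Kb] := compact_bound Kc.
  exists b; split => //.
  apply: (@exp_small_sub _ _ _ _ _ _ (fun eps => [set w | ~ K (X eps w (p j.+1))])).
    by move=> eps _ w /= bX /Kb; rewrite leNgt bX.
  by apply/exp_smallP.
have [b Hb] := choice tight.
pose B := \sum_(j < n) b j.
have Bge j : (j < n)%N -> b j <= B.
  move=> jn; rewrite /B (bigD1 (Ordinal jn)) //= lerDl sumr_ge0 // => i _.
  by case: (Hb i).
have B0 : 0 <= B by rewrite sumr_ge0 // => i _; case: (Hb i).
have B'0 : 0 <= B + n%:R * eta 0%N by rewrite addr_ge0 // mulr_ge0.
exists (wM_ball dl eta (B + n%:R * eta 0%N)); first exact: wM_ball_compact.
apply/exp_smallP.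
(* Off the large oscillations and these finitely many large grid values, the path lies in the
   compact set. *)
pose big eps := \bigcup_(j in `I_n) [set w | b j < `|X eps w (p j.+1)|].
apply: (@exp_small_sub _ _ _ _ _ _ (fun eps => large_oscillation beta X N eps `|` big eps)).
  move=> eps e0 w notK; apply: contrapT => good; apply: notK.
  have wMle m : (wM (X eps w) (dl m) <= (eta m)%:E)%E.
    rewrite leNgt; apply/negP => H; apply: good; left.
    by exists (N.+1 + m)%N; split; [rewrite addSn ltnS leq_addr|].
  split => //; first exact: Xc.
  have bd j : (j <= n)%N -> `|X eps w (p j)| <= B.
    case: j => [|j] jn; first by rewrite p0 X0 // normr0.
    apply: le_trans (Bge j jn); rewrite leNgt; apply/negP => H; apply: good; right.
    by exists j.
  move=> t t01; rewrite -pn in t01.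
  exact: (wM_sup_bound (Xc _ e0 w) B0 (eta0 0%N) (wMle 0%N) p0 p01 pdl bd (leqnn n)).
apply: exp_small_setU => //; first exact/exp_smallP.
by apply: exp_small_bigcup => // j jn; case: (Hb j).
Qed.
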